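(* Let $R$ be a commutative Noetherian ring with non-zero identity, $\mathfrak a$ an ideal of $R$, $\mathcal S$ a Serre subcategory of the category of $R$-modules, $(\mathcal T,\bigstar,\preceq)$ a partially ordered Abelian monoid and $\lambda:\mathcal S\to\mathcal T$ a subadditive function. Let $M$ be a finitely generated $R$-module, $X$ an arbitrary $R$-module, and $m,n$ non-negative integers. Assume that (i) $H^{m+n}_{\mathfrak a}(M,X)$ is in $\mathcal S$, (ii) $\operatorname{Ext}^{m+1+r}_R(M,H^{n-r}_{\mathfrak a}(X))$ is in $\mathcal S$ for all $r$ with $1\le r\le n$, and (iii) $\operatorname{Ext}^{m-1-r}_R(M,H^{n+r}_{\mathfrak a}(X))$ is in $\mathcal S$ for all $r$ with $1\le r\le m-1$. Then $\operatorname{Ext}^m_R(M,H^n_{\mathfrak a}(X))\in\mathcal S$, and $$\lambda\big(\operatorname{Ext}^m_R(M,H^n_{\mathfrak a}(X))\big)\preceq \lambda\big(H^{m+n}_{\mathfrak a}(M,X)\big)\ \bigstar\ \Big(\mathop{\bigstar}_{r=1}^{n}\lambda\big(\operatorname{Ext}^{m+1+r}_R(M,H^{n-r}_{\mathfrak a}(X))\big)\Big)\ \bigstar\ \Big(\mathop{\bigstar}_{r=1}^{m-1}\lambda\big(\operatorname{Ext}^{m-1-r}_R(M,H^{n+r}_{\mathfrak a}(X))\big)\Big).$$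
   Context: $H^i_{\mathfrak a}(M,X)=\varinjlim_{k}\operatorname{Ext}^i_R(M/\mathfrak a^kM,X)$ is the $i$-th generalized local cohomology module, and $H^i_{\mathfrak a}(X)=H^i_{\mathfrak a}(R,X)$ is ordinary local cohomology. A Serre subcategory $\mathcal S$ of the category of $R$-modules is a (nonempty) class of $R$-modules such that for every short exact sequence $0\to X'\to X\to X''\to 0$, $X\in\mathcal S$ if and only if $X',X''\in\mathcal S$. A partially ordered Abelian monoid is a commutative monoid $(\mathcal T,\bigstar)$ with identity element denoted $0$ and a partial order $\preceq$ compatible with $\bigstar$; an empty $\bigstar$-product is the identity. A function $\lambda:\mathcal S\to\mathcal T$ is subadditive if $\lambda(0)=0$ and for every short exact sequence $0\to X'\to X\to X''\to 0$ with all terms in $\mathcal S$: $\lambda(X')\preceq\lambda(X)$, $\lambda(X'')\preceq\lambda(X)$ and $\lambda(X)\preceq\lambda(X')\bigstar\lambda(X'')$. *)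

(* Defs.v *)
From HB Require Import structures.
From mathcomp Require Import all_boot all_order all_algebra.
From mathcomp Require Import boolp.
From mathcomp Require Import freeg.

Set Implicit Arguments.
Unset Strict Implicit.
Unset Printing Implicit Defensive.

Import GRing.Theory.
Local Open Scope ring_scope.
Local Open Scope quotient_scope.

Section HomModule.
Variables (R : comNzRingType) (M X : lmodType R).
Implicit Types f g h : {linear M -> X}.

Lemma linear_ext f g : f =1 g -> f = g.
Proof.
case: f => f [[a1] [s1]]; case: g => g [[a2] [s2]] /= /funext fg; subst g.
by rewrite (Prop_irrelevance a1 a2) (Prop_irrelevance s1 s2).
Qed.

HB.instance Definition _ := gen_eqMixin {linear M -> X}.
HB.instance Definition _ := gen_choiceMixin {linear M -> X}.

Definition hom_zero : {linear M -> X} := \0.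
Definition hom_add f g : {linear M -> X} := f \+ g.
Definition hom_opp f : {linear M -> X} := \- f.
Definition hom_scale (c : R) f : {linear M -> X} := c \*: f.

Lemma hom_addA : associative hom_add.
Proof. by move=> f g h; apply: linear_ext => x /=; rewrite addrA. Qed.
Lemma hom_addC : commutative hom_add.
Proof. by move=> f g; apply: linear_ext => x /=; rewrite addrC. Qed.
Lemma hom_add0 : left_id hom_zero hom_add.
Proof. by move=> f; apply: linear_ext => x /=; rewrite add0r. Qed.
Lemma hom_addN : left_inverse hom_zero hom_opp hom_add.
Proof. by move=> f; apply: linear_ext => x /=; rewrite addNr. Qed.

HB.instance Definition _ := GRing.isZmodule.Build {linear M -> X}
  hom_addA hom_addC hom_add0 hom_addN.

Lemma hom_scaleA a b f : hom_scale a (hom_scale b f) = hom_scale (a * b) f.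
Proof. by apply: linear_ext => x /=; rewrite scalerA. Qed.
Lemma hom_scale1 : left_id 1 hom_scale.
Proof. by move=> f; apply: linear_ext => x /=; rewrite scale1r. Qed.
Lemma hom_scaleDr : right_distributive hom_scale +%R.
Proof. by move=> c f g; apply: linear_ext => x /=; rewrite scalerDr. Qed.
Lemma hom_scaleDl f : {morph hom_scale^~ f : a b / a + b}.
Proof. by move=> a b; apply: linear_ext => x /=; rewrite scalerDl. Qed.

HB.instance Definition _ := GRing.Zmodule_isLmodule.Build R {linear M -> X}
  hom_scaleA hom_scale1 hom_scaleDr hom_scaleDl.

End HomModule.

Section Precomp.
Variables (R : comNzRingType) (M N X : lmodType R) (h : {linear M -> N}).

Definition precomp (f : {linear N -> X}) : {linear M -> X} := f \o h.

Lemma precomp_linear : linear precomp.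
Proof. by move=> c f g; apply: linear_ext. Qed.

HB.instance Definition _ := GRing.isLinear.Build R _ _ _ precomp precomp_linear.
End Precomp.

Section KerIm.
Variables (R : pzRingType) (V W : lmodType R) (f : {linear V -> W}).

Definition ker : {pred V} := [pred x | f x == 0].

Lemma ker_submod : submod_closed ker.
Proof.
split=> [|c x y]; rewrite !inE ?raddf0 // => /eqP fx /eqP fy.
by rewrite linearP fx fy scaler0 addr0.
Qed.
HB.instance Definition _ := GRing.isSubmodClosed.Build R V ker ker_submod.

Definition im : {pred W} := [pred y | `[< exists x, f x = y >]].

Lemma im_submod : submod_closed im.
Proof.
split=> [|c x y]; rewrite !inE; first by apply/asboolP; exists 0; rewrite raddf0.
move=> /asboolP[u <-] /asboolP[v <-]; apply/asboolP; exists (c *: u + v).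
by rewrite linearP.
Qed.
HB.instance Definition _ := GRing.isSubmodClosed.Build R W im im_submod.
End KerIm.

Section Submodule.
Variables (R : pzRingType) (V : lmodType R) (S : submodClosed V).

Record submodule := Submodule { submodule_val : V; _ : submodule_val \in S }.

HB.instance Definition _ := [isSub for submodule_val].
HB.instance Definition _ := [Choice of submodule by <:].
HB.instance Definition _ := [SubChoice_isSubLmodule of submodule by <:].
End Submodule.

Section QuotientModule.
Variables (R : pzRingType) (V : lmodType R) (S : submodClosed V).

(* [submodClosed] does not inherit from [zmodClosed], which [ideal_quot] needs *)
Definition quotmod_pred : {pred V} := S.
Lemma quotmod_pred_zmod : zmod_closed quotmod_pred.
Proof. exact: GRing.submod_closedB (submodClosedP S). Qed.
HB.instance Definition _ := GRing.isZmodClosed.Build V quotmod_pred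
  quotmod_pred_zmod.

Definition quotmod := {ideal_quot quotmod_pred}.
HB.instance Definition _ := GRing.Zmodule.on quotmod.
HB.instance Definition _ := EqQuotient.on quotmod.

Definition quotmod_pi (x : V) : quotmod := \pi_quotmod x.

Lemma quotmod_piE x y : (quotmod_pi x == quotmod_pi y) = (x - y \in S).
Proof. exact: esym (@Quotient.idealrBE _ quotmod_pred x y). Qed.

Lemma quotmod_piP x y : quotmod_pi x = quotmod_pi y <-> x - y \in S.
Proof. by rewrite -quotmod_piE; split=> [->|/eqP]. Qed.

Lemma quotmod_reprP x : repr (quotmod_pi x) - x \in S.
Proof. by apply/quotmod_piP; rewrite /quotmod_pi reprK. Qed.

Lemma quotmod_piD : {morph quotmod_pi : x y / x + y}.
Proof. by move=> x y; rewrite /quotmod_pi raddfD. Qed.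

Lemma quotmod_ind (P : quotmod -> Prop) :
  (forall x, P (quotmod_pi x)) -> forall q, P q.
Proof. by move=> h q; rewrite -[q]reprK; exact: h. Qed.

Definition quotmod_scale (c : R) (q : quotmod) : quotmod :=
  quotmod_pi (c *: repr q).

Lemma quotmod_scaleE c x :
  quotmod_scale c (quotmod_pi x) = quotmod_pi (c *: x).
Proof.
by apply/quotmod_piP; rewrite -scalerBr rpredZ // quotmod_reprP.
Qed.

Lemma quotmod_scaleA a b q :
  quotmod_scale a (quotmod_scale b q) = quotmod_scale (a * b) q.
Proof. by elim/quotmod_ind: q => x; rewrite !quotmod_scaleE scalerA. Qed.
Lemma quotmod_scale1 : left_id 1 quotmod_scale.
Proof. by elim/quotmod_ind => x; rewrite quotmod_scaleE scale1r. Qed.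
Lemma quotmod_scaleDr : right_distributive quotmod_scale +%R.
Proof.
move=> c; elim/quotmod_ind => x; elim/quotmod_ind => y.
by rewrite -quotmod_piD !quotmod_scaleE scalerDr quotmod_piD.
Qed.
Lemma quotmod_scaleDl q : {morph quotmod_scale^~ q : a b / a + b}.
Proof.
by move=> a b; elim/quotmod_ind: q => x; rewrite !quotmod_scaleE scalerDl quotmod_piD.
Qed.

HB.instance Definition _ := GRing.Zmodule_isLmodule.Build R quotmod
  quotmod_scaleA quotmod_scale1 quotmod_scaleDr quotmod_scaleDl.

Lemma quotmod_pi_linear : linear quotmod_pi.
Proof. by move=> c x y; rewrite quotmod_piD -quotmod_scaleE. Qed.
HB.instance Definition _ := GRing.isLinear.Build R _ _ _ quotmod_pi
  quotmod_pi_linear.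
End QuotientModule.

Section QuotientMap.
Variables (R : pzRingType) (V W : lmodType R).
Variables (S : submodClosed V) (S' : submodClosed W) (f : {linear V -> W}).
Hypothesis fS : forall x, x \in S -> f x \in S'.

Definition quotmod_map (_ : forall x, x \in S -> f x \in S') (q : quotmod S) :
  quotmod S' := quotmod_pi S' (f (repr q)).

Lemma quotmod_mapE x :
  quotmod_map fS (quotmod_pi S x) = quotmod_pi S' (f x).
Proof.
by apply/quotmod_piP; rewrite -raddfB; apply: fS; exact: quotmod_reprP.
Qed.

Lemma quotmod_map_linear : linear (quotmod_map fS).
Proof.
move=> c; elim/quotmod_ind => x; elim/quotmod_ind => y.
by rewrite -linearP !quotmod_mapE !linearP.
Qed.
HB.instance Definition _ := GRing.isLinear.Build R _ _ _ (quotmod_map fS)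
  quotmod_map_linear.
End QuotientMap.

Section SubmoduleMap.
Variables (R : pzRingType) (V W : lmodType R).
Variables (S : submodClosed V) (S' : submodClosed W) (f : {linear V -> W}).
Hypothesis fS : forall x, x \in S -> f x \in S'.

Definition submodule_map (x : submodule S) : submodule S' :=
  Submodule (fS (valP x)).

Lemma submodule_map_linear : linear submodule_map.
Proof. by move=> c x y; apply: val_inj; rewrite /= !linearP. Qed.
HB.instance Definition _ := GRing.isLinear.Build R _ _ _ submodule_map
  submodule_map_linear.
End SubmoduleMap.

Section Cohomology.
Variables (R : pzRingType) (C : nat -> lmodType R).
Variable (d : forall i, {linear C i -> C i.+1}).

(* [C] is extended by 0 in negative degrees *)
Definition coboundary i : {pred C i} :=
  match i return {pred C i} with 0 => [pred x | x == 0] | j.+1 => im (d j) end.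
Arguments coboundary : clear implicits.

Definition coboundary_cocycle i : {pred submodule (ker (d i))} :=
  [pred z | submodule_val z \in coboundary i].
Arguments coboundary_cocycle : clear implicits.

Lemma coboundary_cocycle_submod i : submod_closed (coboundary_cocycle i).
Proof.
case: i => [|i]; split=> [|c x y].
- exact: eqxx.
- by rewrite !inE /= => /eqP-> /eqP->; rewrite scaler0 addr0.
- exact: (rpred0 (im (d i))).
- by move=> hx hy; apply: (rpredD (rpredZ c (hx : submodule_val x \in im (d i)))).
Qed.
HB.instance Definition _ i := GRing.isSubmodClosed.Build R _
  (coboundary_cocycle i) (@coboundary_cocycle_submod i).

Definition cohomology i : lmodType R := quotmod (coboundary_cocycle i).
End Cohomology.
Arguments coboundary {R C} d i.
Arguments coboundary_cocycle {R C} d i.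
Arguments cohomology {R C} d i.

Section CohomologyMap.
Variables (R : pzRingType) (C D : nat -> lmodType R).
Variables (dC : forall i, {linear C i -> C i.+1}).
Variables (dD : forall i, {linear D i -> D i.+1}).
Variable (phi : forall i, {linear C i -> D i}).
Hypothesis phi_d : forall i x, phi i.+1 (dC i x) = dD i (phi i x).

Lemma cocycle_map i x : x \in ker (dC i) -> phi i x \in ker (dD i).
Proof. by rewrite !inE -phi_d => /eqP->; rewrite raddf0. Qed.

Lemma coboundary_map i z : z \in coboundary_cocycle dC i ->
  submodule_map (@cocycle_map i) z \in coboundary_cocycle dD i.
Proof.
case: i z => [|i] z; rewrite !inE /=; first by move=> /eqP->; rewrite raddf0.
by move=> /asboolP[y <-]; apply/asboolP; exists (phi i y); rewrite -phi_d.
Qed.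

Definition cohomology_map i : {linear cohomology dC i -> cohomology dD i} :=
  quotmod_map (@coboundary_map i).
End CohomologyMap.

Section DependentProduct.
Variables (R : pzRingType) (E : nat -> lmodType R).

Definition dprod := forall k, E k.
Implicit Types x y z : dprod.

HB.instance Definition _ := gen_eqMixin dprod.
HB.instance Definition _ := gen_choiceMixin dprod.

Definition dprod_zero : dprod := fun k => 0.
Definition dprod_add x y : dprod := fun k => x k + y k.
Definition dprod_opp x : dprod := fun k => - x k.
Definition dprod_scale (c : R) x : dprod := fun k => c *: x k.

Lemma dprod_ext x y : (forall k, x k = y k) -> x = y.
Proof. exact: functional_extensionality_dep. Qed.

Lemma dprod_addA : associative dprod_add.
Proof. by move=> x y z; apply: dprod_ext => k; apply: addrA. Qed.
Lemma dprod_addC : commutative dprod_add.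
Proof. by move=> x y; apply: dprod_ext => k; apply: addrC. Qed.
Lemma dprod_add0 : left_id dprod_zero dprod_add.
Proof. by move=> x; apply: dprod_ext => k; apply: add0r. Qed.
Lemma dprod_addN : left_inverse dprod_zero dprod_opp dprod_add.
Proof. by move=> x; apply: dprod_ext => k; apply: addNr. Qed.

HB.instance Definition _ := GRing.isZmodule.Build dprod
  dprod_addA dprod_addC dprod_add0 dprod_addN.

Lemma dprod_scaleA a b x : dprod_scale a (dprod_scale b x) = dprod_scale (a * b) x.
Proof. by apply: dprod_ext => k; apply: scalerA. Qed.
Lemma dprod_scale1 : left_id 1 dprod_scale.
Proof. by move=> x; apply: dprod_ext => k; apply: scale1r. Qed.
Lemma dprod_scaleDr : right_distributive dprod_scale +%R.
Proof. by move=> c x y; apply: dprod_ext => k; apply: scalerDr. Qed.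
Lemma dprod_scaleDl x : {morph dprod_scale^~ x : a b / a + b}.
Proof. by move=> a b; apply: dprod_ext => k; apply: scalerDl. Qed.

HB.instance Definition _ := GRing.Zmodule_isLmodule.Build R dprod
  dprod_scaleA dprod_scale1 dprod_scaleDr dprod_scaleDl.

Definition finite_support : {pred dprod} :=
  [pred x : dprod | `[< exists N, forall k, (N <= k)%N -> x k = 0 >]].

Lemma finite_support_submod : submod_closed finite_support.
Proof.
split=> [|c x y]; rewrite !inE; first by apply/asboolP; exists 0%N.
move=> /asboolP[N xN] /asboolP[N' yN']; apply/asboolP; exists (maxn N N') => k.
rewrite geq_max => /andP[Nk N'k].
by rewrite -[LHS]/(c *: x k + y k) xN // yN' // scaler0 addr0.
Qed.
HB.instance Definition _ := GRing.isSubmodClosed.Build R dprod finite_support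
  finite_support_submod.

Definition dsum : lmodType R := submodule finite_support.
End DependentProduct.
Arguments finite_support {R} E.

Section DirectLimit.
Variables (R : pzRingType) (E : nat -> lmodType R).
Variable (t : forall k, {linear E k -> E k.+1}).

Definition shift_fun (x : dprod E) : dprod E :=
  fun k => match k return E k with 0 => 0 | j.+1 => t j (x j) end.

Lemma shift_fun_linear : linear shift_fun.
Proof.
by move=> c x y; apply: dprod_ext => -[|k]; rewrite -[RHS]/(c *: _ + _) /= ?linearP // scaler0 addr0.
Qed.
HB.instance Definition _ := GRing.isLinear.Build R _ _ _ shift_fun
  shift_fun_linear.

Lemma shift_fun_support x : x \in finite_support E -> shift_fun x \in finite_support E.
Proof.
rewrite !inE => /asboolP[N xN]; apply/asboolP; exists N.+1 => -[|k] //= Nk.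
by rewrite xN // raddf0.
Qed.

Definition shift : {linear dsum E -> dsum E} := submodule_map shift_fun_support.

Definition id_sub_shift (x : dsum E) : dsum E := x - shift x.

Lemma id_sub_shift_linear : linear id_sub_shift.
Proof. by move=> c x y; rewrite /id_sub_shift linearP opprD addrACA scalerBr. Qed.
HB.instance Definition _ := GRing.isLinear.Build R _ _ _ id_sub_shift
  id_sub_shift_linear.

(* The direct sum modulo the submodule generated by the elements
   [x - t k x] ([x] in [E k], placed in degrees [k] and [k.+1]). *)
Definition direct_limit : lmodType R := quotmod (im id_sub_shift).
End DirectLimit.

Section FreeModule.
Variables (R : comNzRingType) (K : choiceType) (M : lmodType R) (u : K -> M).

Definition free_lift : {freeg K / R} -> M := fglift u.

HB.instance Definition _ := GRing.isZmodMorphism.Build {freeg K / R} M free_lift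
  (lift_is_additive u).

Lemma free_lift_scalable : scalable free_lift.
Proof.
move=> c D; have -> : free_lift D = \sum_(x <- dom D) coeff x D *: u x.
  rewrite -[in LHS](freeg_sumE D) raddf_sum.
  by apply: eq_bigr => x _; rewrite /= /free_lift liftU.
rewrite -[c *: D]/(fgscale c D) /fgscale raddf_sum scaler_sumr.
by apply: eq_bigr => x _; rewrite /= /free_lift liftU scalerA.
Qed.
HB.instance Definition _ := GRing.isScalable.Build R {freeg K / R} M _ free_lift
  free_lift_scalable.

Lemma free_liftU x : free_lift << x >> = u x.
Proof. by rewrite /free_lift liftU scale1r. Qed.
End FreeModule.

Section FreeModuleExt.
Variables (R : comNzRingType) (K : choiceType) (M : lmodType R).

Lemma free_ext (f g : {linear {freeg K / R} -> M}) :
  (forall x : K, f << x >> = g << x >>) -> f =1 g.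
Proof.
move=> fg D; rewrite -[D]freeg_sumE !raddf_sum; apply: eq_bigr => x _.
suff -> : << coeff x D *g x >> = coeff x D *: << x >> :> {freeg K / R}.
  by rewrite /= !linearZ /= fg.
by apply/eqP/freeg_eqP => y; rewrite coeffZ !coeffU mul1r.
Qed.
End FreeModuleExt.

Section Resolution.
Variable R : comNzRingType.
Implicit Types M N : lmodType R.

(* [cover M] is free on the elements of [M]; [syz M] is the kernel of the
   tautological surjection [cover M -> M]. Iterating yields a free resolution
   that is functorial in [M]. *)
Definition cover M : lmodType R := {freeg M / R}.
Definition cover_eps M : {linear cover M -> M} := free_lift (@id M).
Definition syz M : lmodType R := submodule (ker (cover_eps M)).
Definition syz_incl M : {linear syz M -> cover M} :=
  (val : submodule (ker (cover_eps M)) -> cover M).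

Fixpoint syzn i M : lmodType R := if i is j.+1 then syz (syzn j M) else M.

Definition res M i : lmodType R := cover (syzn i M).
Definition res_d M i : {linear res M i.+1 -> res M i} :=
  syz_incl (syzn i M) \o cover_eps (syzn i.+1 M).

Section Map.
Variables (M N : lmodType R) (f : {linear M -> N}).

Definition cover_map : {linear cover M -> cover N} :=
  free_lift (fun x : M => << f x >> : {freeg N / R}).

Lemma cover_mapE x : cover_eps N (cover_map x) = f (cover_eps M x).
Proof.
apply: (free_ext (f := cover_eps N \o cover_map) (g := f \o cover_eps M)) => y.
by rewrite /= !free_liftU.
Qed.

Lemma cover_map_ker x : x \in ker (cover_eps M) -> cover_map x \in ker (cover_eps N).
Proof. by rewrite !inE cover_mapE => /eqP->; rewrite raddf0. Qed.

Definition syz_map : {linear syz M -> syz N} := submodule_map cover_map_ker.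
End Map.

Fixpoint syzn_map M N (f : {linear M -> N}) i : {linear syzn i M -> syzn i N} :=
  match i return {linear syzn i M -> syzn i N} with
  | 0 => f
  | j.+1 => syz_map (syzn_map f j)
  end.

Definition res_map M N (f : {linear M -> N}) i : {linear res M i -> res N i} :=
  cover_map (syzn_map f i).

Lemma res_map_d M N (f : {linear M -> N}) i x :
  res_map f i (res_d M i x) = res_d N i (res_map f i.+1 x).
Proof. by rewrite /= cover_mapE. Qed.

Lemma res_dd M i x : res_d M i (res_d M i.+1 x) = 0.
Proof.
have /eqP /= h := valP (cover_eps (syzn i.+2 M) x).
by rewrite /= h.
Qed.

Lemma cover_eps_surj M (x : M) : exists y, cover_eps M y = x.
Proof. by exists << x >>; apply: free_liftU. Qed.

Lemma res_exact M i x :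
  res_d M i x = 0 -> exists y, res_d M i.+1 y = x.
Proof.
move=> dx0; have ker_x : x \in ker (cover_eps (syzn i.+1 M)).
  by rewrite inE; apply/eqP/val_inj; rewrite raddf0.
have [y yx] := cover_eps_surj (Submodule ker_x : syzn i.+2 M).
by exists y; rewrite /= yx.
Qed.

Lemma res_exact0 M x :
  cover_eps M x = 0 -> exists y, res_d M 0 y = x.
Proof.
move=> /eqP ex0; have ker_x : x \in ker (cover_eps M) by [].
have [y yx] := cover_eps_surj (Submodule ker_x : syzn 1 M).
by exists y; rewrite /= yx.
Qed.

End Resolution.

Section Ext.
Variable R : comNzRingType.
Implicit Types M N X : lmodType R.

Definition hom_cx M X i : lmodType R := {linear res M i -> X}.
Definition hom_d M X i : {linear hom_cx M X i -> hom_cx M X i.+1} :=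
  @precomp _ _ _ X (res_d M i).

Definition Ext i M X : lmodType R := cohomology (hom_d M X) i.

Definition hom_map M N X (f : {linear M -> N}) i :
  {linear hom_cx N X i -> hom_cx M X i} := @precomp _ _ _ X (res_map f i).

Lemma hom_map_d M N X (f : {linear M -> N}) i x :
  hom_map X f i.+1 (hom_d N X i x) = hom_d M X i (hom_map X f i x).
Proof. apply: linear_ext => y.
exact: (congr1 (x : {linear res N i -> X}) (esym (res_map_d f y))). Qed.

Definition Ext_map i M N X (f : {linear M -> N}) :
  {linear Ext i N X -> Ext i M X} := cohomology_map (@hom_map_d M N X f) i.
End Ext.

Section IdealPower.
Variables (R : comNzRingType).

(* the submodule [I N], when [N] is a submodule *)
Definition ideal_mul (V : lmodType R) (I : {pred R}) (N : {pred V}) : {pred V} :=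
  [pred y | `[< exists s : seq (R * V),
    (forall p, p \in s -> p.1 \in I /\ p.2 \in N) /\
    y = \sum_(p <- s) p.1 *: p.2 >]].

Lemma ideal_mul_submod (V : lmodType R) (I : {pred R}) (N : {pred V}) :
  submod_closed N -> submod_closed (ideal_mul I N).
Proof.
move=> [N0 NP]; split=> [|c x y]; rewrite !inE.
  by apply/asboolP; exists [::]; rewrite big_nil.
move=> /asboolP[s [sI ->]] /asboolP[s' [s'I ->]]; apply/asboolP.
exists ([seq (p.1, c *: p.2) | p <- s] ++ s'); split.
  move=> p; rewrite mem_cat => /orP[/mapP[q /sI[qI qN] ->]|/s'I] //=.
  by split=> //; rewrite -[c *: _]addr0 NP.
rewrite big_cat big_map scaler_sumr; congr (_ + _).
by apply: eq_bigr => p _; rewrite /= !scalerA mulrC.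
Qed.

Fixpoint ideal_pow (a : {pred R}) k : {pred R} :=
  if k is j.+1 then ideal_mul (V := R^o) a (ideal_pow a j) else predT.

Lemma ideal_pow_submod (a : {pred R}) k :
  submod_closed (ideal_pow a k : {pred R^o}).
Proof. by elim: k => [|k IHk] //; apply: ideal_mul_submod. Qed.

Lemma ideal_pow_sub (a : {pred R}) k x :
  x \in ideal_pow a k.+1 -> x \in ideal_pow a k.
Proof.
have [pow0 powP] := ideal_pow_submod a k.
rewrite /= inE => /asboolP[s [sP ->]]; rewrite big_seq.
elim/big_rec: _ => [//|p y ps yP]; apply: powP => //.
by have [] := sP p ps.
Qed.

Definition ideal_mulT (V : lmodType R) (I : {pred R}) : {pred V} :=
  ideal_mul I predT.
Arguments ideal_mulT : clear implicits.

Lemma ideal_mulT_submod V I : submod_closed (ideal_mulT V I).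
Proof. exact: ideal_mul_submod. Qed.
HB.instance Definition _ V I := GRing.isSubmodClosed.Build R V (ideal_mulT V I)
  (ideal_mulT_submod V I).

Lemma ideal_mulT_sub (V : lmodType R) (I J : {pred R}) :
  {subset I <= J} -> {subset ideal_mulT V I <= ideal_mulT V J}.
Proof.
move=> IJ x; rewrite !inE => /asboolP[s [sI ->]]; apply/asboolP; exists s.
by split=> // p /sI[/IJ].
Qed.
End IdealPower.
Arguments ideal_mulT {R} V I.

Section LocalCohomology.
Variables (R : comNzRingType) (a : submodClosed R^o).
Implicit Types M X : lmodType R.

Definition quot_pow M k : lmodType R := quotmod (ideal_mulT M (ideal_pow a k)).

Lemma quot_pow_sub M k (x : M) :
  x \in ideal_mulT M (ideal_pow a k.+1) ->
  (idfun : {linear M -> M}) x \in ideal_mulT M (ideal_pow a k).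
Proof. by apply: ideal_mulT_sub => y; apply: ideal_pow_sub. Qed.

Definition quot_pow_map M k : {linear quot_pow M k.+1 -> quot_pow M k} :=
  quotmod_map (@quot_pow_sub M k).

Definition gen_local_cohomology i M X : lmodType R :=
  direct_limit (fun k => Ext_map i X (quot_pow_map M k)).

Definition local_cohomology i X : lmodType R := gen_local_cohomology i R^o X.
End LocalCohomology.

Section Serre.
Variable R : comNzRingType.

Definition fin_gen (V : lmodType R) (N : {pred V}) : Prop :=
  exists s : seq V, forall x, x \in N <->
    exists c : 'I_(size s) -> R, x = \sum_(j < size s) c j *: s`_j.

Definition fin_gen_module (M : lmodType R) : Prop := fin_gen (V := M) predT.

Definition noetherian : Prop := forall I : submodClosed R^o, fin_gen I.

Definition short_exact (X' X X'' : lmodType R)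
    (f : {linear X' -> X}) (g : {linear X -> X''}) : Prop :=
  [/\ injective f, forall x, g x = 0 <-> (exists x', f x' = x)
    & forall x'', exists x, g x = x''].

Definition serre (S : lmodType R -> Prop) : Prop :=
  (exists X, S X) /\
  forall (X' X X'' : lmodType R) (f : {linear X' -> X}) (g : {linear X -> X''}),
    short_exact f g -> (S X <-> S X' /\ S X'').

Variables (disp : Order.disp_t) (T : porderType disp) (e : T).
Variable star : Monoid.com_law e.

Definition star_monotone : Prop :=
  forall x y z : T, (x <= y)%O -> (star x z <= star y z)%O.

(* [lambda] is total, but only its values on [S] are constrained; the zero
   module is only determined up to isomorphism *)
Definition subadditive (S : lmodType R -> Prop) (lambda : lmodType R -> T) : Prop :=
  (forall X : lmodType R, S X -> (forall x : X, x = 0) -> lambda X = e) /\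
  forall (X' X X'' : lmodType R) (f : {linear X' -> X}) (g : {linear X -> X''}),
    S X' -> S X -> S X'' -> short_exact f g ->
    [/\ (lambda X' <= lambda X)%O, (lambda X'' <= lambda X)%O
      & (lambda X <= star (lambda X') (lambda X''))%O].
End Serre.

(* Main.v *)
Require Import Defs.
From HB Require Import structures.
From mathcomp Require Import all_boot all_order all_algebra.
From mathcomp Require Import boolp.
From mathcomp Require Import freeg.
From mathcomp Require classical_sets.

(** The hypotheses are those that make the [(m, n)] spot of the spectral
    sequence [Ext^p(M, H^q_a(X)) => H^{p+q}_a(M, X)] controllable from the
    abutment.  No spectral sequence is needed: three-term exact sequences suffice.

    Embed [X] in an injective module [E] (here [env X]), let [cosyz X = E / X],
    and iterate.  With [Y_q] the [q]-th cosyzygy, [G] the [a]-torsion functor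
    ([Gam]) and [J_q = G(E(Y_q))], put [Z_q = G(Y_q)], let [B_{q+1}] be the image
    of [J_q -> Z_{q+1}], with [B_0 = 0], and let [H_q = Z_q / B_q].  There are
    exact sequences

      [0 -> Z_q -> J_q -> B_{q+1} -> 0]  and  [0 -> B_q -> Z_q -> H_q -> 0].

    Three facts connect them with the statement.
    - Over a noetherian ring [J_q] is injective ([Gam_injective]), so that
      [Ext^p(M, B_{q+1})] is [Ext^{p+1}(M, Z_q)] for [p > 0].
    - If [N] is finitely generated, [H^i_a(N, X)] is the cokernel of
      [Hom(N, J_{i-1}) -> Hom(N, Z_i)] ([gen_loc_rel]): a linear map from [N] to a
      torsion module factors through some [N / a^k N], and shifting dimensions
      along the cosyzygies identifies [Ext^i(N / a^k N, X)] with a cokernel of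
      the same kind.
    - The case [N = R] gives [H^i_a(X) = H_i] ([inj_cohomology_iso]).

    Now [Ext^m(M, H_n)] lies between [Ext^m(M, Z_n)] and [Ext^{m+1}(M, B_n)].
    Going down in [q], [Ext^p(M, B_q)] is built from
    [Ext^{p+r}(M, H_{q-r})], [1 <= r <= q], until [B_0 = 0] is reached
    ([bounded_Ext_bound]); this gives the first product.  Going up,
    [Ext^p(M, Z_q) = Ext^{p-1}(M, B_{q+1})] is built from [Ext^{p-2}(M, H_{q+1})]
    and [Ext^{p-1}(M, Z_{q+1})], until [Ext^1(M, Z_{p+q-1})], which embeds in the
    cokernel [H^{p+q}_a(M, X)] ([bounded_Ext_cocycle]); this gives the second
    product.  When [m = 0] the module [Hom(M, Z_n)] may be outside the Serre
    class, but its image in [Hom(M, H_n)] is a quotient of [H^n_a(M, X)].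

    Throughout, homomorphisms that would have to be defined by choices (connecting
    maps, comparison with direct limits) are handled as linear relations: to bound
    [X] by [Y] it is enough to exhibit [X] as a subquotient of [Y]
    ([bounded_rel]). *)

Set Implicit Arguments.
Unset Strict Implicit.
Unset Printing Implicit Defensive.

Import GRing.Theory Num.Theory.
Local Open Scope ring_scope.

(** * Linear relations *)

Section LinearRelations.
Variable R : comNzRingType.
Implicit Types V W X Y : lmodType R.

Definition linpred V (P : V -> Prop) : Prop :=
  P 0 /\ forall c x y, P x -> P y -> P (c *: x + y).

Definition linrel V W (rho : V -> W -> Prop) : Prop :=
  rho 0 0 /\ forall c x y x' y',
    rho x y -> rho x' y' -> rho (c *: x + x') (c *: y + y').

Lemma linrelD V W (rho : V -> W -> Prop) x y x' y' : linrel rho ->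
  rho x y -> rho x' y' -> rho (x + x') (y + y').
Proof. by move=> [_ h] h1 h2; have := h 1 _ _ _ _ h1 h2; rewrite !scale1r. Qed.

Lemma linrelZ V W (rho : V -> W -> Prop) c x y : linrel rho ->
  rho x y -> rho (c *: x) (c *: y).
Proof. by move=> [h0 h] h1; have := h c _ _ _ _ h1 h0; rewrite !addr0. Qed.

Lemma linrelB V W (rho : V -> W -> Prop) x y x' y' : linrel rho ->
  rho x y -> rho x' y' -> rho (x - x') (y - y').
Proof.
move=> hr h1 h2; apply: linrelD => //.
by have := linrelZ (-1) hr h2; rewrite !scaleN1r.
Qed.

Lemma linrel_flip V W (rho : V -> W -> Prop) :
  linrel rho -> linrel (fun y x => rho x y).
Proof. by case=> h0 h; split=> // c x y x' y'; apply: h. Qed.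

Definition predset V (P : V -> Prop) : {pred V} := [pred x | `[< P x >]].

Lemma predset_submod V (P : V -> Prop) : linpred P -> submod_closed (predset P).
Proof.
case=> h0 h; split=> [|c x y]; rewrite !inE; first exact/asboolP.
by move=> /asboolP hx /asboolP hy; apply/asboolP/h.
Qed.

Definition mksub V (P : V -> Prop) (HP : linpred P) : submodClosed V :=
  HB.pack (predset P) (GRing.isSubmodClosed.Build R V _ (predset_submod HP)).

Lemma mksubE V (P : V -> Prop) (HP : linpred P) x : x \in mksub HP <-> P x.
Proof. by split=> [/asboolP|/asboolP]. Qed.

Definition mklin V W (f : V -> W) (Hf : linear f) : {linear V -> W} :=
  HB.pack f (GRing.isLinear.Build R V W _ f Hf).

(** For maps that are easier to characterise than to write down. *)
Lemma linrel_fun V W (rho : V -> W -> Prop) : linrel rho ->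
  (forall x, exists y, rho x y) -> (forall y, rho 0 y -> y = 0) ->
  exists f : {linear V -> W}, forall x, rho x (f x).
Proof.
move=> hr ht hf; pose f x := projT1 (cid (ht x)).
have fP x : rho x (f x) by exact: projT2 (cid (ht x)).
have fU x y : rho x y -> y = f x.
  move=> h; apply/eqP; rewrite -subr_eq0; apply/eqP/hf.
  by rewrite -(subrr x); apply: linrelB.
have fL : linear f by move=> c x y; apply/esym/fU; case: hr => _; apply.
by exists (mklin fL).
Qed.

Lemma linrel_uniq V W (rho : V -> W -> Prop) x y y' : linrel rho ->
  (forall y, rho 0 y -> y = 0) -> rho x y -> rho x y' -> y = y'.
Proof.
move=> hr hf h1 h2; apply/eqP; rewrite -subr_eq0; apply/eqP/hf.
by rewrite -(subrr x); apply: linrelB.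
Qed.

Lemma factor_surj V W X (p : {linear V -> W}) (f : {linear V -> X}) :
  (forall y, exists x, p x = y) -> (forall x, p x = 0 -> f x = 0) ->
  exists g : {linear W -> X}, forall x, g (p x) = f x.
Proof.
move=> ps pf.
have [] := @linrel_fun W X (fun y z => exists x, y = p x /\ z = f x).
- split=> [|c _ _ _ _ [x [-> ->]] [x' [-> ->]]]; first by exists 0; rewrite !raddf0.
  by exists (c *: x + x'); rewrite !linearP.
- by move=> y; have [x <-] := ps y; exists (f x), x.
- by move=> y [x [/esym/pf e ->]].
move=> g gP; exists g => x; have [x' [e ->]] := gP (p x).
apply/eqP; rewrite -subr_eq0 -raddfB; apply/eqP/pf.
by rewrite raddfB /= e subrr.
Qed.

Lemma factor_inj V W X (i : {linear V -> W}) (f : {linear X -> W}) :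
  injective i -> (forall x, exists y, i y = f x) ->
  exists g : {linear X -> V}, forall x, i (g x) = f x.
Proof.
move=> ii fi.
have [] := @linrel_fun X V (fun x y => i y = f x).
- by split=> [|c x y x' y' h h']; rewrite ?raddf0 // !linearP h h'.
- exact: fi.
- by move=> y; rewrite raddf0 -(raddf0 i) => /ii.
by move=> g gP; exists g.
Qed.

Lemma quotmod_pi_eq0 V (U : submodClosed V) x : quotmod_pi U x = 0 <-> x \in U.
Proof. by rewrite -(raddf0 (quotmod_pi U)) quotmod_piP subr0. Qed.

Lemma imP V W (f : {linear V -> W}) y : y \in im f <-> exists x, f x = y.
Proof. by split=> /asboolP. Qed.

Lemma kerP V W (f : {linear V -> W}) y : y \in ker f <-> f y = 0.
Proof. by split=> /eqP. Qed.

Lemma sub_short_exact V (U : submodClosed V) :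
  short_exact (val : {linear submodule U -> V}) (quotmod_pi U : {linear V -> _}).
Proof.
split; first exact: val_inj.
- move=> x; rewrite quotmod_pi_eq0; split=> [xU|[x' <-]]; last exact: valP.
  by exists (Submodule xU).
by elim/quotmod_ind => x; exists x.
Qed.

Lemma ker_short_exact V W (f : {linear V -> W}) : (forall y, exists x, f x = y) ->
  short_exact (val : {linear submodule (ker f) -> V}) f.
Proof.
move=> fs; split=> //; first exact: val_inj.
move=> x; split=> [/kerP xU|[x' <-]]; first by exists (Submodule xU).
by apply/kerP/valP.
Qed.
End LinearRelations.

(** * Bounds for modules of a Serre class *)

Section Bounded.
Variables (R : comNzRingType) (S : lmodType R -> Prop) (S_serre : serre S).
Variables (disp : Order.disp_t) (T : porderType disp) (e : T).
Variables (star : Monoid.com_law e) (star_mono : star_monotone star).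
Variables (lambda : lmodType R -> T) (lambda_sub : subadditive star S lambda).
Implicit Types X Y : lmodType R.

(** Membership in [S] and the estimate of [lambda] always propagate together. *)
Definition bounded X (t : T) := S X /\ (lambda X <= t)%O.

Lemma star_le2 x y x' y' : (x <= x')%O -> (y <= y')%O -> (star x y <= star x' y')%O.
Proof.
move=> xx' yy'; apply: (@Order.le_trans _ _ (star x' y)); first exact: star_mono.
by rewrite (Monoid.mulmC star x' y) (Monoid.mulmC star x' y'); apply: star_mono.
Qed.

Lemma bounded0 X : (forall x : X, x = 0) -> bounded X e.
Proof.
move=> X0; have SX : S X.
  case: S_serre => [[Y SY] hS]; suff h : short_exact (\0 : {linear X -> Y}) (idfun : {linear Y -> Y}).
    by have [] := (hS _ _ _ _ _ h).1 SY.
  split.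
  - by move=> x y _; rewrite (X0 x) (X0 y).
  - by move=> x /=; split=> [->|[_ <-]] //; exists 0.
  - by move=> x; exists x.
by split=> //; rewrite (lambda_sub.1 X SX X0).
Qed.

Lemma bounded_ext X' X X'' (f : {linear X' -> X}) (g : {linear X -> X''}) s t :
  short_exact f g -> bounded X' s -> bounded X'' t -> bounded X (star s t).
Proof.
move=> fg [S1 l1] [S2 l2]; have SX : S X by apply/(S_serre.2 _ _ _ _ _ fg).
split=> //; have [_ _ h] := lambda_sub.2 _ _ _ _ _ S1 SX S2 fg.
by apply: (Order.le_trans h); apply: star_le2.
Qed.

Lemma bounded_sub X' X X'' (f : {linear X' -> X}) (g : {linear X -> X''}) t :
  short_exact f g -> bounded X t -> bounded X' t /\ bounded X'' t.
Proof.
move=> fg [SX l]; have [S1 S2] := (S_serre.2 _ _ _ _ _ fg).1 SX.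
have [h1 h2 _] := lambda_sub.2 _ _ _ _ _ S1 SX S2 fg.
by split; split=> //; apply: Order.le_trans l.
Qed.

(** A total injective linear relation from [X] to [Y] displays [X] as a
    subquotient of [Y]: the quotient of its range by the image of [0]. *)
Lemma bounded_rel X Y (rho : X -> Y -> Prop) t : linrel rho ->
  (forall x, exists y, rho x y) -> (forall x, rho x 0 -> x = 0) ->
  bounded Y t -> bounded X t.
Proof.
move=> hr ht hi bY.
have Dlin : linpred (fun y => exists x, rho x y).
  split=> [|c y y' [x h] [x' h']]; first by exists 0; case: hr.
  by exists (c *: x + x'); case: hr => _; apply.
have [bD _] := bounded_sub (sub_short_exact (mksub Dlin)) bY.
have [] := @linrel_fun _ (submodule (mksub Dlin)) X (fun y x => rho x (val y)).
- by split=> [|c x y x' y' h h']; [case: hr | case: hr => _; apply].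
- by move=> [y yD]; apply/(mksubE Dlin).
- by move=> x /hi.
move=> f fP; have fs x : exists y, f y = x.
  have [y xy] := ht x; have yD : y \in mksub Dlin by apply/mksubE; exists x.
  exists (Submodule yD); have h := fP (Submodule yD).
  by apply/eqP; rewrite -subr_eq0; apply/eqP/hi; rewrite -(subrr y); apply: linrelB.
by have [] := bounded_sub (ker_short_exact fs) bD.
Qed.

(** Exactness in the middle: [sigma] is a relation out of [X] whose kernel is
    a subquotient of [X'] through [tau]. *)
Lemma bounded_exact X' X X'' (tau : X -> X' -> Prop) (sigma : X -> X'' -> Prop) s t :
  linrel tau -> linrel sigma ->
  (forall x, exists y, sigma x y) ->
  (forall x, sigma x 0 -> exists y, tau x y) -> (forall x, tau x 0 -> x = 0) ->
  bounded X' s -> bounded X'' t -> bounded X (star s t).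
Proof.
move=> htau hsig st st0 ti bX' bX''.
have Klin : linpred (fun x => sigma x 0).
  split=> [|c x x' h h']; first by case: hsig.
  by rewrite -[X in sigma _ X](addr0 0) -{1}(scaler0 _ c); case: hsig => _; apply.
apply: (bounded_ext (sub_short_exact (mksub Klin))).
  apply: (@bounded_rel _ X' (fun x y => tau (val x) y)) bX' => //.
  - by split=> [|c x y x' y' h h']; [case: htau | case: htau => _; apply].
  - by move=> [x xK]; apply: st0; apply/(mksubE Klin).
  - by move=> x /ti h; apply: val_inj.
apply: (@bounded_rel _ X'' (fun q y => exists x, q = quotmod_pi (mksub Klin) x /\ sigma x y)) bX''.
- split=> [|c q y q' y' [x [-> h]] [x' [-> h']]].
    by exists 0; rewrite raddf0; case: hsig.
  by exists (c *: x + x'); rewrite linearP; split=> //; case: hsig => _; apply.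
- by elim/quotmod_ind => x; have [y h] := st x; exists y, x.
- by move=> q [x [-> h]]; apply/quotmod_pi_eq0/mksubE.
Qed.
End Bounded.

(** * Ext through syzygies *)

Local Notation lin f := (f : {linear _ -> _}).

Section ExtClasses.
Variable R : comNzRingType.
Implicit Types P N A B C X Y : lmodType R.

Lemma eps_surj P i (x : syzn i P) : exists y : res P i, cover_eps (syzn i P) y = x.
Proof. exact: cover_eps_surj. Qed.

Lemma eps_incl P i (x : syzn i.+1 P) :
  cover_eps (syzn i P) (syz_incl (syzn i P) x) = 0.
Proof. by apply/kerP/(valP x). Qed.

Lemma cover_lift P B C (p : {linear B -> C}) (f : {linear Defs.cover P -> C}) :
  (forall y, exists x, p x = y) ->
  exists g : {linear Defs.cover P -> B}, forall x, p (g x) = f x.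
Proof.
move=> ps; pose u (x : P) := projT1 (cid (ps (f << x >>))).
exists (free_lift u) => x.
apply: (free_ext (f := p \o free_lift u) (g := f)) => y /=.
by rewrite free_liftU /u; case: cid.
Qed.

(** The sequence [syzn i.+1 P -> res P i -> syzn i P -> 0] is exact. *)
Lemma eps_factor P i X (f : {linear res P i -> X}) :
  (forall x : syzn i.+1 P, f (syz_incl (syzn i P) x) = 0) ->
  exists g : {linear syzn i P -> X}, forall x, g (cover_eps (syzn i P) x) = f x.
Proof.
move=> h; apply: factor_surj => [|x ex0]; first exact: eps_surj.
by have xK : x \in ker (cover_eps (syzn i P)); [apply/kerP|apply: (h (Submodule xK))].
Qed.

Lemma cls_cocycle P X i (h : {linear syzn i P -> X}) :
  ((h \o cover_eps (syzn i P) : {linear res P i -> X}) : hom_cx P X i)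
    \in ker (hom_d P X i).
Proof.
apply/kerP/linear_ext => x /=.
have -> : cover_eps (syzn i P) (syz_incl (syzn i P) (cover_eps (syzn i.+1 P) x)) = 0.
  exact: eps_incl.
by rewrite raddf0.
Qed.

(** A cocycle on [res P i] vanishes on the image of [res P i.+1], that is on
    [syzn i.+1 P], so it is a linear map on [syzn i P].  Working with those maps
    removes the cocycle condition from all later arguments. *)
Definition cls P X i (h : {linear syzn i P -> X}) : Ext i P X :=
  quotmod_pi (coboundary_cocycle (hom_d P X) i) (Submodule (cls_cocycle h)).

Lemma clsP P X i c (f g : {linear syzn i P -> X}) :
  cls (c *: f + g) = c *: cls f + cls g.
Proof.
rewrite /cls -linearP; congr (quotmod_pi _ _).
by apply: val_inj; apply: linear_ext.
Qed.

(** The maps of class zero: for [i > 0], those that extend to the free module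
    containing the syzygy. *)
Definition bnd P X i : {linear syzn i P -> X} -> Prop :=
  match i return {linear syzn i P -> X} -> Prop with
  | 0 => fun h => forall x, h x = 0
  | j.+1 => fun h => exists g : {linear res P j -> X},
      forall x, h x = g (syz_incl (syzn j P) x)
  end.

Lemma cls_surj P X i (c : Ext i P X) : exists h, c = cls h.
Proof.
elim/quotmod_ind: c => -[z zK].
have [|h hP] := @eps_factor P i X z.
  move=> x; have [y <-] := eps_surj x.
  by move/kerP: zK => /(congr1 (fun f : {linear res P i.+1 -> X} => f y)).
exists h; congr (quotmod_pi _ _); apply: val_inj; apply: linear_ext => x /=.
by rewrite hP.
Qed.

Lemma cls0 P X i (h : {linear syzn i P -> X}) : cls h = 0 <-> bnd h.
Proof.
rewrite quotmod_pi_eq0; case: i h => [|i] h; rewrite inE /=.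
  split=> [/eqP h0 x|h0].
    have [y <-] := @eps_surj P 0 x.
    exact: (congr1 (fun f : {linear res P 0 -> X} => f y) h0).
  by apply/eqP/linear_ext => x; rewrite /= h0.
split=> [/imP[g gP]|[g gP]].
  exists g => x; have [y <-] := @eps_surj P i.+1 x.
  exact: (congr1 (fun f : {linear res P i.+1 -> X} => f y) (esym gP)).
by apply/imP; exists g; apply: linear_ext => x; rewrite /= gP.
Qed.

Lemma cls_map P N (f : {linear N -> P}) X i (h : {linear syzn i P -> X}) :
  Ext_map i X f (cls h) = cls (h \o syzn_map f i).
Proof.
rewrite /Ext_map /cohomology_map /= quotmod_mapE; congr (quotmod_pi _ _).
by apply: val_inj; apply: linear_ext => x /=; rewrite cover_mapE.
Qed.

Lemma bnd_linpred P X i : linpred (@bnd P X i).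
Proof.
split=> [|c f g /cls0 f0 /cls0 g0]; apply/cls0; last by rewrite clsP f0 g0 scaler0 addr0.
by have /esym := clsP (-1) (0 : {linear syzn i P -> X}) 0; rewrite !scaleN1r !addNr.
Qed.

Lemma bnd_0 P X i : bnd (0 : {linear syzn i P -> X}).
Proof. exact: (bnd_linpred P X i).1. Qed.

Lemma cls_eq P X i (f g : {linear syzn i P -> X}) : bnd (f - g) -> cls f = cls g.
Proof.
move=> /cls0 h; apply/eqP; rewrite -subr_eq0; apply/eqP; rewrite -h.
by rewrite addrC -scaleN1r -clsP scaleN1r addrC.
Qed.

Lemma bnd_comp P X Y i (f : {linear X -> Y}) (h : {linear syzn i P -> X}) :
  bnd h -> bnd (f \o h : {linear syzn i P -> Y}).
Proof.
case: i h => [|i] h /=; first by move=> h0 x; rewrite h0 raddf0.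
by move=> [g gP]; exists (f \o g) => x /=; rewrite gP.
Qed.

Lemma bnd_eq P X i (f g : {linear syzn i P -> X}) : f =1 g -> bnd f -> bnd g.
Proof. by move=> /linear_ext ->. Qed.
End ExtClasses.

(** * The long exact sequence of Ext *)

Section LongExactSequence.
Variables (R : comNzRingType) (P A B C : lmodType R).
Variables (io : {linear A -> B}) (pi : {linear B -> C}).
Hypothesis ex : short_exact io pi.

Let io_inj : injective io. Proof. by case: ex. Qed.
Let pi_surj y : exists x, pi x = y. Proof. by case: ex. Qed.
Let pi_io x : pi (io x) = 0.
Proof. by case: ex => _ /(_ (io x)) [_ h] _; apply: h; exists x. Qed.
Let exact_mid x : pi x = 0 -> exists y, io y = x.
Proof. by case: ex => _ /(_ x) [h _] _. Qed.

(** Exactness at [Ext i P B]: the extension [g] of [pi \o h] lifts to [B] because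
    [res P j] is free, and subtracting the lift moves [h] into [A]. *)
Lemma Ext_middle i (h : {linear syzn i P -> B}) :
  bnd (pi \o h : {linear syzn i P -> C}) ->
  exists a : {linear syzn i P -> A}, bnd (h - lin (io \o a)).
Proof.
case: i h => [|i] h /=.
  move=> h0; have [|a aP] := @factor_inj _ _ _ _ io h io_inj.
    by move=> x; apply: exact_mid.
  by exists a => x /=; rewrite aP subrr.
move=> [g gP]; have [g' g'P] := cover_lift g pi_surj.
have [|a aP] := @factor_inj _ _ _ _ io (h - lin (g' \o syz_incl (syzn i P))) io_inj.
  by move=> x; apply: exact_mid; rewrite /= raddfB /= g'P -gP subrr.
by exists a; exists g' => x /=; rewrite aP /= opprB addrC subrK.
Qed.

(** [conn h a]: the class of [a] is the image of the class of [h] under the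
    connecting homomorphism, [b] being the lift used to compute it. *)
Definition conn i (h : {linear syzn i P -> C}) (a : {linear syzn i.+1 P -> A}) :=
  exists b : {linear res P i -> B},
    (forall x, pi (b x) = h (cover_eps (syzn i P) x)) /\
    (forall x, io (a x) = b (syz_incl (syzn i P) x)).

Lemma conn_linrel i : linrel (@conn i).
Proof.
split=> [|c h a h' a' [b [b1 b2]] [b' [b1' b2']]].
  by exists 0; split=> x /=; rewrite ?raddf0.
exists (c *: b + b'); split=> x /=; first by rewrite linearP b1 b1'.
by rewrite linearP b2 b2'.
Qed.

Lemma conn_total i (h : {linear syzn i P -> C}) : exists a, conn h a.
Proof.
have [b bP] := cover_lift (h \o cover_eps (syzn i P)) pi_surj.
have [|a aP] := @factor_inj _ _ _ _ io (b \o syz_incl (syzn i P)) io_inj.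
  by move=> x; apply: exact_mid; rewrite /= bP /= eps_incl raddf0.
by exists a, b.
Qed.

(** Exactness at [Ext i P C]: correcting the lift [b] by an extension of [a]
    makes it vanish on [syzn i.+1 P], hence descend to [syzn i P]. *)
Lemma conn_bnd i (h : {linear syzn i P -> C}) a : conn h a -> bnd a ->
  exists h' : {linear syzn i P -> B}, forall x, pi (h' x) = h x.
Proof.
move=> [b [b1 b2]] [g gP].
have [|h' h'P] := @eps_factor _ P i B (b - lin (io \o g)).
  by move=> x /=; rewrite -b2 gP subrr.
exists h' => x; have [y <-] := eps_surj x.
by rewrite h'P /= raddfB /= b1 pi_io subr0.
Qed.

(** The connecting homomorphism is well defined: if [h] extends to a free module
    then the extension lifts to [B], and [b] can be changed to a map to [A]. *)
Lemma bnd_conn i (h : {linear syzn i P -> C}) a : conn h a -> bnd h -> bnd a.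
Proof.
case: i h a => [|i] h a [b [b1 b2]] /=.
  move=> h0; have [|g gP] := @factor_inj _ _ _ _ io b io_inj.
    by move=> x; apply: exact_mid; rewrite b1 h0.
  by exists g => x; apply: io_inj; rewrite gP b2.
move=> [g gP]; have [g' g'P] := cover_lift g pi_surj.
have [|a' a'P] := @factor_inj _ _ _ _ io
    (b - lin (g' \o syz_incl (syzn i P) \o cover_eps (syzn i.+1 P))) io_inj.
  by move=> x; apply: exact_mid; rewrite /= raddfB /= b1 g'P -gP subrr.
exists a' => x; apply: io_inj; rewrite a'P /= b2.
have -> : cover_eps (syzn i.+1 P) (syz_incl (syzn i.+1 P) x) = 0 by exact: eps_incl.
by rewrite !raddf0 addr0.
Qed.

(** The composite of [Ext i P B -> Ext i P C] with the connecting map is zero. *)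
Lemma conn_lift i (h' : {linear syzn i P -> B}) (h : {linear syzn i P -> C}) a :
  (forall x, pi (h' x) = h x) -> conn h a -> bnd a.
Proof.
move=> hh' [b [b1 b2]].
have [|g gP] := @factor_inj _ _ _ _ io (b - lin (h' \o cover_eps (syzn i P))) io_inj.
  by move=> x; apply: exact_mid; rewrite /= raddfB /= b1 hh' subrr.
by exists g => x; apply: io_inj; rewrite gP /= eps_incl raddf0 subr0.
Qed.

(** Exactness at [Ext i.+1 P A]: an extension of [io \o a] to the free module
    vanishes on the syzygy after composition with [pi], hence descends. *)
Lemma conn_exact i (a : {linear syzn i.+1 P -> A}) :
  bnd (io \o a : {linear syzn i.+1 P -> B}) -> exists h, conn h a.
Proof.
move=> [b bP]; have [|h hP] := @eps_factor _ P i C (pi \o b).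
  by move=> x /=; rewrite -bP pi_io.
by exists h, b; split=> x; [exact: esym (hP x)|exact: bP].
Qed.
End LongExactSequence.

Lemma conn_map (R : comNzRingType) (P N A B C : lmodType R)
    (io : {linear A -> B}) (pi : {linear B -> C}) (f : {linear N -> P}) i
    (h : {linear syzn i P -> C}) (a : {linear syzn i.+1 P -> A}) :
  conn io pi h a ->
  conn io pi (h \o syzn_map f i) (a \o syzn_map f i.+1).
Proof.
move=> [b [b1 b2]]; exists (b \o res_map f i); split=> x /=.
  by rewrite b1 cover_mapE.
by rewrite b2.
Qed.

(** * Injective modules *)

Section Injective.
Variable R : comNzRingType.
Implicit Types V E : lmodType R.

Definition partial V E (rho : V -> E -> Prop) : Prop :=
  linrel rho /\ forall y, rho 0 y -> y = 0.

(** Partial maps are given by their graphs, so that the domain needs no type of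
    its own; injectivity of the map from the domain is then automatic. *)
Definition injective_module E : Prop :=
  forall V (rho : V -> E -> Prop), partial rho ->
  exists g : {linear V -> E}, forall v y, rho v y -> g v = y.

Definition baer E : Prop :=
  forall rho : R^o -> E -> Prop, partial rho ->
  exists e : E, forall r y, rho r y -> y = (r : R) *: e.

(** The heart of Baer's criterion: [r |-> sigma (r v)] is a partial map out of the
    ring, hence is multiplication by some [e], and [e] can serve as the value
    at [v]. *)
Lemma baer_extend_one V E (rho : V -> E -> Prop) v : baer E -> partial rho ->
  exists sigma : V -> E -> Prop, [/\ partial sigma,
    (forall w y, rho w y -> sigma w y) & exists y, sigma v y].
Proof.
move=> hB [hr hf].
have [] := hB (fun r y => rho ((r : R) *: v) y).
  split=> [|y]; last by rewrite scale0r => /hf.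
  split=> [|c r y r' y' h h']; first by rewrite scale0r; case: hr.
  by rewrite scalerDl -scalerA; case: hr => _; apply.
move=> e eP.
exists (fun w y => exists r w' y', [/\ rho w' y', w = r *: v + w' & y = r *: e + y']).
split; first split; first split.
- by exists 0, 0, 0; rewrite !scale0r !addr0; split=> //; case: hr.
- move=> c _ _ _ _ [r [w [y [h -> ->]]]] [r' [w' [y' [h' -> ->]]]].
  exists (c * r + r'), (c *: w + w'), (c *: y + y'); split.
  + by case: hr => _; apply.
  + by rewrite scalerDr scalerDl scalerA addrACA.
  + by rewrite scalerDr scalerDl scalerA addrACA.
- move=> y [r [w' [y' [h e0 ->]]]].
  have w'E : w' = (- r) *: v by apply/eqP; rewrite scaleNr -addr_eq0 addrC -e0.
  by move: h; rewrite w'E => /eP ->; rewrite scaleNr subrr.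
- by move=> w y h; exists 0, w, y; rewrite !scale0r !add0r.
exists e, 1, 0, 0; rewrite !scale1r !addr0; split=> //; by case: hr.
Qed.

(** Baer's criterion: a maximal partial map is total by [baer_extend_one]. *)
Lemma baer_injective E : baer E -> injective_module E.
Proof.
move=> hB V rho rhoP.
pose T := {sigma : V -> E -> Prop |
  partial sigma /\ forall v y, rho v y -> sigma v y}.
pose le (s t : T) := `[< forall v y, sval s v y -> sval t v y >].
have t0 : T by exists rho.
have [] := @classical_sets.ZL_preorder T t0 le.
- by move=> t; apply/asboolP.
- by move=> r s t /asboolP h /asboolP h'; apply/asboolP => v y /h /h'.
- move=> A Atot; case: (pselect (exists t, A t)) => [[t At]|nA]; last first.
    by exists t0 => s As; case: nA; exists s.
  pose U v y := exists2 s, A s & sval s v y.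
  have hU : partial U /\ forall v y, rho v y -> U v y.
    split; last by move=> v y h; exists t => //; case: (svalP t) => _; apply.
    split; last by move=> y [s As]; case: (svalP s) => -[_ +] _; apply.
    split; first by exists t => //; case: (svalP t) => -[[]].
    move=> c x y x' y' [s As h] [s' As' h'].
    have [/asboolP ss'|/asboolP s's] := Atot s s' As As'.
      by exists s' => //; case: (svalP s') => -[[_ +] _] _; apply=> //; apply: ss'.
    by exists s => //; case: (svalP s) => -[[_ +] _] _; apply=> //; apply: s's.
  by exists (exist _ U hU) => s As; apply/asboolP => v y h; exists s.
move=> m mmax; have [mP rm] := svalP m.
have mtot v : exists y, sval m v y.
  have [s [sP ms [y svy]]] := baer_extend_one v hB mP.
  have sT : partial s /\ forall v y, rho v y -> s v y.
    by split=> // w z /rm /ms.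
  exists y; have /asboolP := mmax (exist _ s sT) (asboolT ms).
  exact.
have [g gP] := linrel_fun mP.1 mtot mP.2.
by exists g => v y /rm h; apply: linrel_uniq (gP v) h; [case: mP|case: mP].
Qed.

(** A map on the syzygy is a partial map on the free module [res P i]. *)
Lemma Ext_injective P E i (h : {linear syzn i.+1 P -> E}) :
  injective_module E -> bnd h.
Proof.
move=> hE.
have [] := hE _ (fun x y => exists z, x = syz_incl (syzn i P) z /\ y = h z).
  split=> [|y [z [z0 ->]]].
    split=> [|c _ _ _ _ [z [-> ->]] [z' [-> ->]]].
      by exists 0; rewrite !raddf0.
    by exists (c *: z + z'); rewrite !linearP.
  suff -> : z = 0 by rewrite raddf0.
  by apply: val_inj; rewrite raddf0 -z0.
by move=> g gP; exists g => x; apply/esym/gP; exists x.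
Qed.
End Injective.

(** * Enough injectives *)

(** Over the integers, [X] is the quotient of the free group on its own elements
    by the relations among them; dividing the rational vector space with the
    same basis by the same relations gives a divisible group containing [X]. *)
Section DivisibleHull.
Variable X : zmodType.

Definition rat_free : lmodType int := zmodule {freeg X / rat}.

Definition int_eval : {linear {freeg X / int} -> zmodule X} :=
  free_lift (fun x : X => x : zmodule X).

(** The kernel of [int_eval], transported to rational coefficients. *)
Definition hull_rel (u : rat_free) : Prop :=
  exists v : {freeg X / int}, int_eval v = 0 /\
    forall x, coeff x (u : {freeg X / rat}) = (coeff x v)%:~R.

Lemma hull_rel_linpred : linpred hull_rel.
Proof.
split; first by exists 0; split=> [|x]; rewrite ?raddf0 // !coeff0.
move=> c x y [v [v0 vE]] [v' [v0' vE']]; exists (c *: v + v'); split.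
  by rewrite (linearP int_eval) v0 v0' scaler0 addr0.
move=> z; rewrite !coeffD coeffZ vE' rmorphD rmorphM; congr (_ + _).
rewrite scalezrE /=.
have -> : coeff z ((x : {freeg X / rat}) *~ c) = coeff z (x : {freeg X / rat}) *~ c.
  exact: raddfMz.
by rewrite vE mulrzl.
Qed.

Definition div_hull : lmodType int := quotmod (mksub hull_rel_linpred).

Definition div_incl (x : X) : div_hull :=
  quotmod_pi (mksub hull_rel_linpred) (<< x >> : {freeg X / rat}).

Lemma div_inclD x y : div_incl (x + y) = div_incl x + div_incl y.
Proof.
rewrite /div_incl -quotmod_piD; apply/quotmod_piP/mksubE.
exists (<< x + y >> - (<< x >> + << y >>)); split=> [|z].
  by rewrite (raddfB int_eval) (raddfD int_eval) /= !free_liftU subrr.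
by rewrite !coeffB !coeffD !coeffU !mul1r rmorphB rmorphD /= !rmorph_nat.
Qed.

Lemma div_incl_inj x : div_incl x = 0 -> x = 0.
Proof.
move=> /quotmod_pi_eq0/mksubE [v [v0 vE]].
suff vx : v = << x >> by move: v0; rewrite vx /int_eval /= free_liftU.
apply/eqP/freeg_eqP => z; have := vE z; rewrite !coeffU !mul1r.
by rewrite pmulrn -natz => /intr_inj.
Qed.

Lemma div_hull_div (d : div_hull) (n : int) : n != 0 -> exists d', d = n *: d'.
Proof.
move=> n0; elim/quotmod_ind: d => u.
exists (quotmod_pi (mksub hull_rel_linpred) ((n%:~R : rat)^-1 *: (u : {freeg X / rat}))).
rewrite -linearZ /=; congr (quotmod_pi _ _).
rewrite scalezrE /= -scaler_int scalerA mulfV ?scale1r //.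
by rewrite intr_eq0.
Qed.

(** The domain of a partial map out of the integers is generated by its least
    positive element [n], if there is one; the value at [n] is divisible by [n]. *)
Lemma div_hull_baer : baer div_hull.
Proof.
move=> rho [hr hf]; pose P k := (0 < k)%N && `[< exists y, rho (k : int) y >].
have [exP|nP] := pselect (exists k, P k); last first.
  exists 0 => r y h; rewrite scaler0; apply: hf.
  suff r0 : r = 0 by rewrite -r0.
  apply: contrapT => /eqP r0; apply: nP; exists `|r|%N.
  rewrite /P absz_gt0 r0 /=; apply/asboolP.
  case: (ger0P (r : int)) => [rp|rn]; first by exists y; rewrite gez0_abs.
  exists (- y); rewrite ltz0_abs //.
  by have := linrelZ (-1) hr h; rewrite !scaleN1r.
case: (ex_minnP exP) => n /andP[n0 /asboolP[y ny]] nmin.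
have nz : (n : int) != 0 by rewrite -lt0n in n0 *; case: (n) n0.
have [e eE] := div_hull_div y nz; exists e => r z rz.
have hs : rho ((r %% n)%Z : int^o) (z - (r %/ n)%Z *: y).
  have := linrelB hr rz (linrelZ ((r %/ n)%Z) hr ny).
  by rewrite /modz.
have s0 : (r %% n)%Z = 0.
  apply: contrapT => /eqP s0.
  have sp : (0 <= (r %% n)%Z)%R by apply: modz_ge0.
  have := nmin `|(r %% n)%Z|%N.
  rewrite /P absz_gt0 s0 /= => h; have : (n <= `|(r %% n)%Z|)%N.
    by apply/h/asboolP; exists (z - (r %/ n)%Z *: y); rewrite gez0_abs.
  rewrite leqNgt => /negP; apply; rewrite -ltz_nat gez0_abs //.
  by apply: ltz_pmod; rewrite ltz_nat.
move: hs; rewrite s0 => /hf/eqP; rewrite subr_eq0 => /eqP ->.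
rewrite eE scalerA; congr (_ *: _).
by rewrite [in RHS](divz_eq r n) s0 addr0.
Qed.
End DivisibleHull.

(** Coinduction [Hom_Z(R, -)] is right adjoint to the forgetful functor from
    [R]-modules to groups, which is exact; so it preserves injectivity. *)
Section Coinduced.
Variables (R : comNzRingType) (D : lmodType int).

Definition coind : Type := {linear zmodule R -> D}.
HB.instance Definition _ := GRing.Zmodule.on coind.

Lemma coind_scale_linear (c : R) (f : coind) :
  linear (fun r : zmodule R => (f : {linear zmodule R -> D}) (c * (r : R))).
Proof.
move=> k x y; rewrite -linearP; congr ((f : {linear _ -> _}) _).
by rewrite !scalezrE mulrDr mulrzAr.
Qed.

Definition coind_scale (c : R) (f : coind) : coind :=
  mklin (coind_scale_linear c f).

Lemma coind_scaleE c (f : coind) r :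
  (coind_scale c f : {linear _ -> _}) r = (f : {linear _ -> _}) (c * r).
Proof. by []. Qed.

Lemma coind_scaleA a b f : coind_scale a (coind_scale b f) = coind_scale (a * b) f.
Proof.
by apply: linear_ext => r; rewrite !coind_scaleE mulrCA mulrA.
Qed.
Lemma coind_scale1 : left_id 1 coind_scale.
Proof. by move=> f; apply: linear_ext => r; rewrite coind_scaleE mul1r. Qed.
Lemma coind_scaleDr : right_distributive coind_scale +%R.
Proof. by move=> c f g; apply: linear_ext. Qed.
Lemma coind_scaleDl f : {morph coind_scale^~ f : a b / a + b}.
Proof.
move=> a b; apply: linear_ext => r.
by rewrite /coind_scale /= mulrDl (raddfD (f : {linear _ -> _})).
Qed.

HB.instance Definition _ := GRing.Zmodule_isLmodule.Build R coind
  coind_scaleA coind_scale1 coind_scaleDr coind_scaleDl.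

Definition coind_ev (f : coind) (r : R) : D :=
  (f : {linear zmodule R -> D}) (r : zmodule R).

Lemma coind_evP (c : R) (f g : coind) r :
  coind_ev (c *: f + g) r = coind_ev f (c * r) + coind_ev g r.
Proof. by []. Qed.

Lemma coind_ext (f g : coind) : (forall r, coind_ev f r = coind_ev g r) -> f = g.
Proof. by move=> h; apply: linear_ext. Qed.

Lemma coind_additive (h : R -> D) : (forall x y, h (x + y) = h x + h y) ->
  exists f : coind, forall r, coind_ev f r = h r.
Proof.
move=> hD.
have h0 : h 0 = 0 by apply: (addrI (h 0)); rewrite -hD !addr0.
have hZ (k : int) x : h (x *~ k) = k *: h x.
  elim/int_ind: k => [|n IH|n IH]; first by rewrite scale0r mulr0z.
    by rewrite -addn1 PoszD mulrzDr hD IH scalerDl scale1r.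
  have hN y : h (- y) = - h y.
    by apply/eqP; rewrite -addr_eq0 -hD addNr h0.
  by rewrite -addn1 PoszD opprD mulrzBr hD hN IH scalerBl scale1r.
have hl : linear (h : zmodule R -> D) by move=> k x y; rewrite hD hZ.
by exists (mklin hl).
Qed.

(** A partial map [rho] to [coind] corresponds to the partial map
    [v |-> coind_ev (rho v) 1] to [D]; the extension [g] of the latter comes from
    the linear map [v |-> (r |-> g (r v))]. *)
Lemma coind_injective : injective_module D -> injective_module coind.
Proof.
move=> hD V rho [hr hf].
have [] := hD (zmodule V) (fun v d => exists2 f, rho v f & d = coind_ev f 1).
  split; last by move=> y [f /hf -> ->].
  split=> [|k v d v' d' [f h ->] [f' h' ->]].
    by exists 0 => //; case: hr.
  exists (k%:~R *: f + f'); first rewrite scalezrE -scaler_int; first by case: hr => _; apply.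
  rewrite coind_evP; congr (_ + _).
  have fl : linear (coind_ev f : zmodule R -> D) := linearP (f : {linear zmodule R -> D}).
  by rewrite mulr1; have := linearZ_LR (mklin fl) k (1 : zmodule R); rewrite /= scalezrE => ->.
move=> g gP.
have ev_ex v : exists f : coind, forall r, coind_ev f r = g (r *: v).
  by apply: coind_additive => x y; rewrite scalerDl raddfD.
have [] := @linrel_fun _ V coind (fun v f => forall r, coind_ev f r = g (r *: v)).
- split=> [r|c v f v' f' h h' r]; first by rewrite scaler0 raddf0.
  by rewrite coind_evP h h' scalerDr raddfD scalerA mulrC.
- exact: ev_ex.
- by move=> f h; apply: coind_ext => r; rewrite h scaler0 raddf0.
move=> G GP; exists G => v f h; apply: coind_ext => r; rewrite GP.
apply: gP; exists (r *: f); first exact: linrelZ.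
by have := coind_evP r f 0 1; rewrite addr0 mulr1 => ->; rewrite addr0.
Qed.
End Coinduced.

Section Envelope.
Variable R : comNzRingType.
Implicit Types X : lmodType R.

(** The map [x |-> (r |-> div_incl (r x))] embeds [X] in this module. *)
Definition env X : lmodType R := coind R (div_hull X).

Lemma env_injective X : injective_module (env X).
Proof. exact/coind_injective/baer_injective/div_hull_baer. Qed.

Lemma env_incl_ex X : exists i : {linear X -> env X}, injective i.
Proof.
have [] := @linrel_fun _ X (env X)
  (fun x f => forall r, coind_ev f r = div_incl (r *: x)).
- split=> [r|c x f x' f' h h' r].
    by rewrite scaler0; apply/esym; apply: (addrI (div_incl 0)); rewrite -div_inclD !addr0.
  by rewrite coind_evP h h' scalerDr div_inclD scalerA mulrC.
- by move=> x; apply: coind_additive => r s; rewrite scalerDl div_inclD.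
- move=> f h; apply: coind_ext => r; rewrite h scaler0.
  by apply: (addrI (div_incl 0)); rewrite -div_inclD !addr0.
move=> i iP; exists i => x y xy; apply/eqP; rewrite -subr_eq0; apply/eqP.
by apply: div_incl_inj; rewrite -[x - y]scale1r -iP raddfB /= xy subrr.
Qed.

Definition env_incl X : {linear X -> env X} := projT1 (cid (env_incl_ex X)).

Lemma env_incl_inj X : injective (env_incl X).
Proof. exact: projT2 (cid (env_incl_ex X)). Qed.

Definition cosyz X : lmodType R := quotmod (im (env_incl X)).
Definition cosyz_pi X : {linear env X -> cosyz X} := quotmod_pi (im (env_incl X)).

Lemma env_short_exact X : short_exact (env_incl X) (cosyz_pi X).
Proof.
split; first exact: env_incl_inj.
- by move=> x; rewrite quotmod_pi_eq0 imP.
by elim/quotmod_ind => x; exists x.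
Qed.
End Envelope.

(** * The torsion functor *)

(** The noetherian property in the form in which it is used: an ascending chain
    of submodules that exhausts a finitely generated one stops. *)
Lemma fin_gen_chain (R : comNzRingType) (V : lmodType R) (N : {pred V})
    (U : nat -> V -> Prop) : fin_gen N -> (forall k, linpred (U k)) ->
  (forall k x, U k x -> U k.+1 x) -> (forall x, x \in N -> exists k, U k x) ->
  exists K, forall x, x \in N -> U K x.
Proof.
move=> [s sP] Ulin Uinc Uall.
have Umono k l x : (k <= l)%N -> U k x -> U l x.
  by move=> /subnK <-; elim: (l - k)%N => // n IH /IH /Uinc.
have sN (j : 'I_(size s)) : exists k, U k s`_j.
  apply: Uall; apply/sP; exists (fun i => (i == j)%:R).
  rewrite (bigD1 j) //= eqxx scale1r big1 ?addr0 // => i /negPf ->.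
  by rewrite scale0r.
pose K := (\max_(j < size s) projT1 (cid (sN j)))%N.
exists K => x /sP[c ->].
elim/big_rec: _ => [|j y _ yU]; first exact: (Ulin _).1.
apply: (Ulin _).2 => //; apply: Umono (projT2 (cid (sN j))).
exact: (leq_bigmax (F := fun j => projT1 (cid (sN j))) j).
Qed.

Section Torsion.
Variables (R : comNzRingType) (a : submodClosed R^o).
Implicit Types X Y E V : lmodType R.

Lemma ideal_pow_mono k l r : (k <= l)%N ->
  r \in ideal_pow a l -> r \in ideal_pow a k.
Proof. by move=> /subnK <-; elim: (l - k)%N => // n IH /ideal_pow_sub /IH. Qed.

Definition killed Y k (y : Y) : Prop :=
  forall r, r \in ideal_pow a k -> r *: y = 0.

Lemma killed_linpred Y k : linpred (@killed Y k).
Proof.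
split=> [r _|c x y hx hy r ra]; first by rewrite scaler0.
by rewrite scalerDr scalerA mulrC -scalerA hx // hy // scaler0 addr0.
Qed.

Lemma killed_mono Y k l (y : Y) : (k <= l)%N -> killed k y -> killed l y.
Proof. by move=> kl h r /(ideal_pow_mono kl)/h. Qed.

Lemma torsion_linpred Y : linpred (fun y : Y => exists k, killed k y).
Proof.
split=> [|c x y [k hx] [l hy]]; first by exists 0; case: (killed_linpred Y 0).
exists (maxn k l); apply: (killed_linpred Y _).2.
  by apply: killed_mono hx; apply: leq_maxl.
by apply: killed_mono hy; apply: leq_maxr.
Qed.

Definition Gam Y : lmodType R := submodule (mksub (torsion_linpred Y)).

Lemma GamP Y (y : Gam Y) : exists k, killed k (val y).
Proof. by apply/(mksubE (torsion_linpred Y))/valP. Qed.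

Definition mkGam Y (y : Y) (h : exists k, killed k y) : Gam Y :=
  Submodule ((mksubE (torsion_linpred Y) y).2 h).

Section Functor.
Variables (X Y : lmodType R) (f : {linear X -> Y}).

Lemma Gam_map_sub x :
  x \in mksub (torsion_linpred X) -> f x \in mksub (torsion_linpred Y).
Proof.
move=> /mksubE [k hk]; apply/mksubE; exists k => r /hk.
by rewrite -linearZ => ->; rewrite raddf0.
Qed.

Definition Gam_map : {linear Gam X -> Gam Y} := submodule_map Gam_map_sub.

Lemma Gam_mapE x : val (Gam_map x) = f (val x).
Proof. by []. Qed.
End Functor.

Lemma Gam_left_exact X Y V (f : {linear X -> Y}) (g : {linear Y -> V}) :
  short_exact f g -> forall y : Gam Y, Gam_map g y = 0 ->
  exists x : Gam X, Gam_map f x = y.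
Proof.
case=> fi fg _ y /(congr1 val); rewrite Gam_mapE raddf0 => /fg[x xy].
have [k hk] := GamP y.
have hx : exists k, killed k x.
  exists k => r /hk; rewrite -xy -linearZ => h; apply: fi.
  by rewrite raddf0.
by exists (mkGam hx); apply: val_inj.
Qed.

Hypothesis R_noeth : noetherian R.

(** Baer's criterion for maps that take their values in [P], which keeps iterated
    torsion submodules inside a fixed module. *)
Definition baer_in E (P : E -> Prop) : Prop :=
  forall rho : R^o -> E -> Prop, partial rho -> (forall r y, rho r y -> P y) ->
  exists e : E, P e /\ forall r y, rho r y -> y = (r : R) *: e.

Lemma noeth_chain (U : nat -> R^o -> Prop) : (forall k, linpred (U k)) ->
  (forall k x, U k x -> U k.+1 x) ->
  exists K, forall k x, U k x -> U K x.
Proof.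
move=> Ulin Uinc.
have Umono k l x : (k <= l)%N -> U k x -> U l x.
  by move=> /subnK <-; elim: (l - k)%N => // n IH /IH /Uinc.
have Ilin : linpred (fun x => exists k, U k x).
  split=> [|c x y [k hx] [l hy]]; first by exists 0%N; case: (Ulin 0%N).
  exists (maxn k l); apply: (Ulin _).2.
    by apply: Umono hx; apply: leq_maxl.
  by apply: Umono hy; apply: leq_maxr.
have [|K KP] := fin_gen_chain (R_noeth (mksub Ilin)) Ulin Uinc.
  by move=> x /mksubE.
by exists K => k x hx; apply: KP; apply/mksubE; exists k.
Qed.

(** For a single ring element [x] the Artin-Rees lemma is elementary.  Let [I] be
    the domain of [rho].  As [I] is finitely generated, [x ^ K0] kills all values;
    as the chain of the ideals [(I : x ^ n)] stops, at [n] say,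
    [x ^ (K0 + n) s \in I] implies [x ^ n s \in I], so that [rho] vanishes on
    [I] cut with [x ^ (K0 + n) R].  It therefore extends to
    [I + x ^ (K0 + n) R] by zero on the second summand, and the element
    representing this extension is killed by [x ^ (K0 + n)]. *)
Lemma baer_in_torsion E (P : E -> Prop) (x : R) : baer_in P ->
  baer_in (fun y => P y /\ exists k, x ^+ k *: y = 0).
Proof.
move=> hP rho [hr hf] rhoP.
have [|| K0 K0P] := @noeth_chain (fun k r => exists2 y, rho r y & x ^+ k *: y = 0).
- move=> k; split=> [|c r r' [y h h0] [y' h' h0']].
    by exists 0; [case: hr | rewrite scaler0].
  exists (c *: y + y'); first by case: hr => _; apply.
  by rewrite scalerDr scalerA mulrC -scalerA h0 h0' scaler0 addr0.
- by move=> k r [y h h0]; exists y => //; rewrite exprS -scalerA h0 scaler0.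
have Kkill r y : rho r y -> x ^+ K0 *: y = 0.
  move=> h; have [_ [k hk]] := rhoP _ _ h.
  have [|y' h' h0'] := K0P k r; first by exists y.
  by rewrite (linrel_uniq hr hf h h').
have [|| n nP] := @noeth_chain (fun n r => exists y, rho (x ^+ n * (r : R)) y).
- move=> k; split=> [|c r r' [y h] [y' h']].
    by exists 0; rewrite mulr0; case: hr.
  exists (c *: y + y').
  have -> : (x ^+ k * (c *: (r : R^o) + r' : R^o) : R) =
      c *: (x ^+ k * (r : R) : R^o) + x ^+ k * (r' : R).
    by rewrite mulrDr; congr (_ + _); rewrite mulrCA.
  by case: hr => _; apply.
- move=> k r [y h]; exists (x *: y); rewrite exprS -mulrA.
  exact: (linrelZ x hr h).
(* the extension by zero; single-valuedness is where both bounds are used *)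
have [] := hP (fun r y => exists i s : R, r = i + x ^+ (K0 + n) * s /\ rho i y).
- split; last first.
    move=> y [i [s [r0 h]]].
    have [|z hz] := nP (K0 + n)%N (- s : R).
      by exists y; rewrite mulrN; move/eqP: r0; rewrite eq_sym addr_eq0 => /eqP <-.
    apply: (linrel_uniq hr hf h); rewrite -(Kkill _ _ hz).
    have -> : i = x ^+ K0 * (x ^+ n * (- s)).
      by rewrite mulrA -exprD mulrN; apply/eqP; rewrite -addr_eq0 -r0.
    exact: (linrelZ (x ^+ K0) hr hz).
  split=> [|c _ y _ y' [i [s [-> h]]] [i' [s' [-> h']]]].
    by exists 0, 0; rewrite mulr0 addr0; split=> //; case: hr.
  exists (c * i + i'), (c * s + s'); split; last by case: hr => _; apply.
  by rewrite /GRing.scale /= !mulrDr addrACA mulrCA.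
- by move=> r y [i [s [_ /rhoP[]]]].
move=> e [eP e1]; exists e; split; last first.
  by move=> r y h; apply: e1; exists r, 0; rewrite mulr0 addr0.
split=> //; exists (K0 + n)%N; apply/esym/e1; exists 0, 1.
by rewrite mulr1 add0r; split=> //; case: hr.
Qed.

(** The elements of [s] are treated one at a time, the torsion with respect to the
    previous ones serving as [P]. *)
Lemma baer_in_gens E (s : seq R) : baer E ->
  baer_in (fun y : E => forall x, x \in s -> exists k, x ^+ k *: y = 0).
Proof.
move=> hE; elim: s => [|x s IH] rho rhoP rho_in.
  by have [e eP] := hE rho rhoP; exists e.
have [|e [[e1 e2] eP]] := baer_in_torsion (x := x) IH rhoP.
  move=> r y /rho_in h; split; last by apply: h; rewrite inE eqxx.
  by move=> z zs; apply: h; rewrite inE zs orbT.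
by exists e; split=> // z; rewrite inE => /orP[/eqP ->|/e1].
Qed.

(** The pigeonhole principle: a long product of generators contains many copies of
    [x] or a long product of the remaining ones. *)
Lemma torsion_words E (s : seq R) (y : E) :
  (forall x, x \in s -> exists k, x ^+ k *: y = 0) ->
  exists N, forall w : seq R, {subset w <= s} -> (N <= size w)%N ->
    (\prod_(r <- w) r) *: y = 0.
Proof.
elim: s => [|x s IH] h.
  by exists 1%N => -[|r w] // ws; have := ws r; rewrite inE eqxx => /(_ isT).
have [|N NP] := IH; first by move=> z zs; apply: h; rewrite inE zs orbT.
have [q qP] := h x (mem_head _ _); exists (N + q)%N => w ws wN.
rewrite (bigID (pred1 x)) /=.
have -> : \prod_(r <- w | r == x) r = x ^+ count_mem x w.
  by rewrite (eq_bigr (fun=> x)) ?big_const_seq ?iter_mulr_1 // => r /eqP.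
case: (leqP q (count_mem x w)) => hq.
  rewrite mulrC -scalerA -(subnK hq) exprD -scalerA qP !scaler0 //.
rewrite -scalerA -big_filter NP ?scaler0 //.
  move=> r; rewrite mem_filter => /andP[rx /ws].
  by rewrite inE (negPf rx).
rewrite size_filter; have := count_predC (pred1 x) w => wE.
rewrite -(leq_add2r q); apply: (leq_trans wN); rewrite -wE addnC.
rewrite (_ : count _ w = count (predC (pred1 x)) w) //.
by rewrite leq_add2l ltnW.
Qed.

(** [a ^ N] is generated by the products of [N] generators of [a]. *)
Lemma words_killed E (s : seq R) : (forall x, x \in a <->
    exists c : 'I_(size s) -> R, x = \sum_(j < size s) c j *: (s`_j : R^o)) ->
  forall N (y : E), (forall w : seq R, {subset w <= s} -> (N = size w)%N ->
    (\prod_(r <- w) r) *: y = 0) -> killed N y.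
Proof.
move=> sP; elim=> [|N IH] y hy r.
  by have := hy [::]; rewrite big_nil scale1r => -> // _; rewrite scaler0.
move=> /asboolP[p [pP ->]]; 
rewrite -[LHS]/((\sum_(q <- p) (q.1 * q.2 : R)) *: y) scaler_suml big_seq.
apply: big1 => -[u v] /pP [/= /sP[c ->] va].
rewrite -[LHS]/(((\sum_(j < size s) (c j * s`_j : R)) * v) *: y).
rewrite mulr_suml scaler_suml; apply: big1 => j _.
rewrite -mulrA (mulrC (s`_j : R)) -scalerA -(scalerA v) (IH (s`_j *: y)) ?scaler0 // => w ws wN.
have := hy (s`_j :: w); rewrite big_cons scalerA mulrC; apply; last by rewrite /= wN.
by move=> z; rewrite inE => /orP[/eqP ->|/ws //]; rewrite mem_nth.
Qed.

Lemma exp_ideal_pow x k : x \in a -> x ^+ k \in ideal_pow a k.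
Proof.
move=> xa; elim: k => [|k IH] //; apply/asboolP; exists [:: (x, x ^+ k)].
by split=> [p|]; rewrite ?inE ?big_seq1 ?exprS // => /eqP ->.
Qed.

(** A partial map to [Gam E] is one to [E] with values killed by powers of the
    generators of [a]; the representing element given by [baer_in_gens] has the
    same property, and therefore is torsion. *)
Lemma Gam_injective E : injective_module E -> injective_module (Gam E).
Proof.
move=> hE; apply: baer_injective => rho [hr hf].
have [s sP] := R_noeth a.
have sa x : x \in s -> x \in a.
  move=> xs; apply/sP; exists (fun i => (i == Ordinal (etrans (index_mem x s) xs))%:R).
  rewrite (bigD1 (Ordinal (etrans (index_mem x s) xs))) //= eqxx scale1r.
  by rewrite big1 ?addr0 ?nth_index // => i /negPf ->; rewrite scale0r.
have [] := @baer_in_gens E s _ (fun r y => exists2 z, rho r z & y = val z).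
- by move=> sg sgP; have [g gP] := hE _ _ sgP; exists (g 1) => r y /gP <-;
    rewrite -linearZ /= /GRing.scale /= mulr1.
- split=> [|y [z /hf -> ->]] //.
  split=> [|c r _ r' _ [z h ->] [z' h' ->]]; first by exists 0 => //; case: hr.
  by exists (c *: z + z') => //; case: hr => _; apply.
- move=> r _ [z _ ->] x /sa xa; have [k hk] := GamP z; exists k.
  by apply: hk; apply: exp_ideal_pow.
move=> e [e1 e2]; have [N NP] := torsion_words e1.
have eG : exists k, killed k e.
  exists N; apply: (words_killed sP) => w ws wN; apply: NP => //.
  by rewrite wN.
exists (mkGam eG) => r y h; apply: val_inj; apply: e2; by exists y.
Qed.
End Torsion.

(** * Elements of direct limits *)

Section DirectLimitElements.
Variables (R : comNzRingType) (E : nat -> lmodType R).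
Variable t : forall k, {linear E k -> E k.+1}.

Definition single k (x : E k) : dprod E := fun j =>
  if @eqP _ k j is ReflectT kj then ecast i (E i) kj x else 0.

Lemma single_same k (x : E k) : single x k = x.
Proof. by rewrite /single; case: eqP => // p; rewrite (eq_irrelevance p erefl). Qed.

Lemma single_diff k (x : E k) j : k <> j -> single x j = 0.
Proof. by rewrite /single; case: eqP. Qed.

Lemma single_support k (x : E k) : single x \in finite_support E.
Proof.
apply/asboolP; exists k.+1 => j kj; apply: single_diff => e.
by move: kj; rewrite e ltnn.
Qed.

Definition dl_in k (x : E k) : direct_limit t :=
  quotmod_pi (im (id_sub_shift t)) (Submodule (single_support x)).

Lemma dl_inP k c (x y : E k) : dl_in (c *: x + y) = c *: dl_in x + dl_in y.
Proof.
rewrite /dl_in -linearP; congr (quotmod_pi _ _); apply: val_inj => /=.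
apply: dprod_ext => j; rewrite -[RHS]/(c *: single x j + single y j) /single.
by case: eqP => [p|_]; [case: _ / p | rewrite scaler0 addr0].
Qed.

Lemma dl_in_t k (x : E k) : dl_in (t k x) = dl_in x.
Proof.
apply/esym/quotmod_piP/imP; exists (Submodule (single_support x)).
rewrite /id_sub_shift; congr (_ - _); apply: val_inj => /=.
apply: dprod_ext => -[|j] /=; first by rewrite single_diff.
have [<-|kj] := pselect (k = j); first by rewrite !single_same.
by rewrite !single_diff ?raddf0 // => -[].
Qed.

Lemma dl_in_eventually k (x : E k) l : (k <= l)%N -> exists y : E l, dl_in x = dl_in y.
Proof.
move=> /subnK <-; elim: (l - k)%N => [|n [y ->]]; first by exists x.
by exists (t _ y); rewrite dl_in_t.
Qed.

(** By induction on the support: the top component is split off, and a sum of two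
    elements coming from terms of the system comes from a common later term. *)
Lemma dl_in_surj (z : direct_limit t) : exists k (x : E k), z = dl_in x.
Proof.
elim/quotmod_ind: z => -[y yf].
have /asboolP[N] := yf; elim: N y yf => [|N IH] y yf y0.
  exists 0%N, 0; congr (quotmod_pi _ _); apply: val_inj; apply: dprod_ext => j.
  rewrite /= y0 // /single; by case: eqP => // p; case: _ / p.
have zf := rpredB yf (single_support (y N)).
have [|k [x zx]] := IH (y - single (y N)) zf.
  move=> j Nj; rewrite -[LHS]/(y j - single (y N) j).
  have [<-|jN] := pselect (N = j); first by rewrite single_same subrr.
  rewrite single_diff // subr0 y0 //.
  by rewrite ltn_neqAle Nj andbT; apply/eqP.
have [w wE] := dl_in_eventually x (leq_maxl k N).
have [w' w'E] := dl_in_eventually (y N) (leq_maxr k N).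
exists (maxn k N), (w + w'); rewrite -[w]scale1r dl_inP scale1r -wE -w'E -zx.
rewrite /dl_in -quotmod_piD; congr (quotmod_pi _ _); apply: val_inj => /=.
by rewrite subrK.
Qed.

Fixpoint trans k j : {linear E k -> E (j + k)%N} :=
  match j return {linear E k -> E (j + k)%N} with
  | 0 => idfun
  | i.+1 => t (i + k)%N \o trans k i
  end.

(** If [x] in degree [k] equals [y - shift y], comparing components degree by
    degree shows that [y] vanishes below [k], is [x] in degree [k], and is the
    image of [x] further up; as [y] has finite support, that image is
    eventually zero. *)
Lemma dl_in_eq0 k (x : E k) : dl_in x = 0 -> exists j, trans k j x = 0.
Proof.
move=> /quotmod_pi_eq0/imP[[y yf] /(congr1 val) /= yE].
have {}yE j : y j - shift_fun t y j = single x j.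
  by rewrite -yE.
have ylt j : (j < k)%N -> y j = 0.
  elim: j => [|j IH] jk; have := yE _; rewrite /=.
    by move=> /(_ 0%N) /=; rewrite subr0 => ->; apply: single_diff => e; rewrite e in jk.
  move=> /(_ j.+1) /=; rewrite (IH (ltnW jk)) raddf0 subr0 => ->.
  by apply: single_diff => e; move: jk; rewrite e ltnn.
have yk : y k = x.
  have := yE k; rewrite single_same => <-; case: k x yE ylt => [|k] x yE ylt /=.
    by rewrite subr0.
  by rewrite (ylt k) // raddf0 subr0.
have ytr j : y (j + k)%N = trans k j x.
  elim: j => [|j IH] //=; rewrite -IH; have := yE (j.+1 + k)%N.
  rewrite /= single_diff => [/eqP|e]; first by rewrite subr_eq0 => /eqP.
  have : (k < j.+1 + k)%N by rewrite addSn ltnS leq_addl.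
  by rewrite -e ltnn.
move: yf => /asboolP[N yN]; exists N; rewrite -ytr; apply: yN; exact: leq_addr.
Qed.

(** The universal property, in a form suited to families of maps [Q] to a quotient
    [W / triv] that are only given as relations: the limit is then isomorphic to
    the quotient, through [rho]. *)
Lemma direct_limit_rel (W : lmodType R) (Q : forall k, E k -> W -> Prop)
    (triv : W -> Prop) :
  (forall k, linrel (@Q k)) -> (forall k x w, Q k x w -> Q k.+1 (t k x) w) ->
  (forall k x, exists w, Q k x w) ->
  (forall w, exists k x, Q k x w) ->
  (forall k w, Q k 0 w -> triv w) ->
  (forall w, triv w -> exists K, forall k x, (K <= k)%N -> Q k x w -> x = 0) ->
  exists rho : direct_limit t -> W -> Prop, [/\ linrel rho,
    forall l, exists w, rho l w, forall w, exists l, rho l w &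
    forall l w, rho l w -> (l = 0 <-> triv w)].
Proof.
move=> Qlin Qt Qtot Qsurj Q0 Qtriv.
have Qtrans k j x w : Q k x w -> Q (j + k)%N (trans k j x) w.
  by move=> h; elim: j => [|j IH] //=; apply: Qt.
have Qup k x w l : Q k x w -> (k <= l)%N ->
    exists y : E l, dl_in x = dl_in y /\ Q l y w.
  move=> h /subnK <-; elim: (l - k)%N => [|n [y [-> h']]]; first by exists x.
  by exists (t _ y); split; [rewrite dl_in_t | apply: Qt].
(* asking for witnesses in all large degrees makes any two elements comparable
   without transporting along equalities of indices *)
pose rho (z : direct_limit t) w := exists K, forall k, (K <= k)%N ->
  exists x : E k, z = dl_in x /\ Q k x w.
have rho_in k x w : Q k x w -> rho (dl_in x) w.
  by move=> h; exists k => l /(Qup _ _ _ _ h).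
exists rho; split.
- split=> [|c z w z' w' [K hK] [K' hK']].
    exists 0%N => k _; exists 0; split; last by case: (Qlin k).
    by have := @dl_inP k (-1) 0 0; rewrite !scaleN1r !addNr.
  exists (maxn K K') => k; rewrite geq_max => /andP[/hK[x [-> h]] /hK'[x' [-> h']]].
  by exists (c *: x + x'); rewrite dl_inP; split=> //; apply: (Qlin k).2.
- move=> z; have [k [x ->]] := dl_in_surj z; have [w h] := Qtot k x.
  by exists w; apply: rho_in h.
- by move=> w; have [k [x h]] := Qsurj w; exists (dl_in x); apply: rho_in h.
move=> z w [K hK]; split=> [z0|tw].
  have [x [zx h]] := hK K (leqnn K).
  have [|j xj] := @dl_in_eq0 K x; first by rewrite -zx.
  by apply: (Q0 (j + K)%N); rewrite -xj; apply: Qtrans.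
have [K' hK'] := Qtriv w tw; have [x [-> /hK' x0]] := hK _ (leq_maxl K K').
rewrite x0 ?leq_maxr //.
by have := @dl_inP (maxn K K') (-1) 0 0; rewrite !scaleN1r !addNr.
Qed.
End DirectLimitElements.

(** * Dimension shifting along cosyzygies *)

Section Cosyzygies.
Variable R : comNzRingType.
Implicit Types X Y Z P N E : lmodType R.

Fixpoint cosyzn i X : lmodType R := if i is j.+1 then cosyz (cosyzn j X) else X.

Lemma cosyznSr i X : cosyzn i.+1 X = cosyzn i (cosyz X).
Proof. by elim: i => //= i ->. Qed.

(** The term of the injective resolution that maps onto [cosyzn i X]; the zero map
    in degree [0] is a choice that makes all later cokernels uniform in [i]. *)
Definition precosyz i X : lmodType R := if i is j.+1 then env (cosyzn j X) else X.
Definition precosyz_map i X : {linear precosyz i X -> cosyzn i X} :=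
  match i return {linear precosyz i X -> cosyzn i X} with
  | 0 => \0
  | j.+1 => cosyz_pi (cosyzn j X)
  end.

Definition lifts_to P E Z (p : {linear E -> Z}) (h : {linear P -> Z}) : Prop :=
  exists g : {linear P -> E}, forall x, h x = p (g x).

(** [Sh] identifies [Ext i P X] with the cokernel of [Hom(P, E) -> Hom(P, Z)]
    naturally in [P].  It is applied to the cosyzygy sequence of [X], but stating it
    for any [p] avoids equalities between iterated cosyzygies. *)
Definition shift_spec i X E Z (p : {linear E -> Z}) : Prop :=
  exists Sh : forall P, {linear P -> Z} -> {linear syzn i P -> X} -> Prop,
  [/\ (forall P, linrel (@Sh P)) /\ (forall P h, exists w, Sh P h w),
    forall P w, exists h w', Sh P h w' /\ bnd (w - w'),
    forall P h w, Sh P h w -> (bnd w <-> lifts_to p h) &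
    forall P N (f : {linear N -> P}) h w, Sh P h w ->
      Sh N (h \o f) (w \o syzn_map f i)].

Lemma shift_spec0 X : shift_spec 0 X (precosyz_map 0 X).
Proof.
exists (fun P (h w : {linear P -> X}) => w = h); split.
- split=> [P|P h]; last by exists h.
  by split=> [|c h w h' w' -> ->].
- by move=> P w; exists w, w; split=> //; rewrite subrr; apply: bnd_0.
- move=> P h w ->; split=> [h0|[g gP] x]; last exact: gP.
  by exists 0 => x; apply: h0.
- by move=> P N f h w ->.
Qed.

(** [Sh] is a composite of connecting maps, each bijective on Ext groups of
    positive degree because those of an injective module vanish; the first one,
    out of degree zero, has as kernel the maps that lift to the envelope. *)
Lemma shift_spec_step i X : shift_spec i.+1 X (precosyz_map i.+1 X).
Proof.
rewrite /precosyz_map /=; elim: i X => [|i IH] X.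
  have ex := env_short_exact X.
  exists (fun P => @conn R P _ _ _ (env_incl X) (cosyz_pi X) 0); split.
  - by split=> [P|P h]; [apply: conn_linrel | apply: conn_total ex _ _].
  - move=> P w; have [h hw] := conn_exact ex (Ext_injective (env_incl X \o w) (@env_injective _ X)).
    by exists h, w; split=> //; rewrite subrr; apply: bnd_0.
  - move=> P h w hw; split=> [/(conn_bnd ex hw)[h' h'P]|[h' h'P]].
      by exists h' => x; rewrite h'P.
    by apply: (@conn_lift _ _ _ _ _ _ _ ex 0 h' h w) hw => x; rewrite h'P.
  - by move=> P N f h w /(conn_map f).
rewrite [cosyzn i.+1 X]cosyznSr; have ex := env_short_exact X.
have [Sh [[Shl Sht] Shs Shk Shn]] := IH (cosyz X).
exists (fun P h w => exists2 u, Sh P h u & conn (env_incl X) (cosyz_pi X) u w); split.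
- split=> [P|P h].
    split=> [|c h w h' w' [u hu uw] [u' hu' uw']].
      by exists 0; [case: (Shl P) | case: (conn_linrel P (env_incl X) (cosyz_pi X) i.+1)].
    by exists (c *: u + u'); [apply: (Shl P).2 | apply: (conn_linrel _ _ _ _).2].
  by have [u hu] := Sht P h; have [w uw] := conn_total ex u; exists w, u.
- move=> P w.
  have [u uw] := conn_exact ex (Ext_injective (env_incl X \o w) (@env_injective _ X)).
  have [h [u' [hu' uu']]] := Shs P u; have [w' uw'] := conn_total ex u'.
  exists h, w'; split; first by exists u'.
  by apply: (bnd_conn ex (linrelB (conn_linrel _ _ _ _) uw uw')).
- move=> P h w [u hu uw]; rewrite -(Shk P h u hu); split=> [bw|bu]; last first.
    exact: (bnd_conn ex uw bu).
  have [u' u'P] := conn_bnd ex uw bw.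
  have := bnd_comp (cosyz_pi X) (Ext_injective u' (@env_injective _ X)).
  by apply: bnd_eq.
- move=> P N f h w [u hu uw]; exists (u \o syzn_map f i.+1); first exact: Shn.
  exact: (conn_map f uw).
Qed.

Lemma shift_specP i X : shift_spec i X (precosyz_map i X).
Proof. by case: i => [|i]; [apply: shift_spec0 | apply: shift_spec_step]. Qed.
End Cosyzygies.

(** * Local cohomology from an injective resolution *)

Section LocalCohomologyCokernel.
Variables (R : comNzRingType) (a : submodClosed R^o).
Implicit Types X Y Z P N E : lmodType R.

Lemma quot_pow_factor N Y k (f : {linear N -> Y}) :
  (forall n, killed a k (f n)) ->
  exists g : {linear quot_pow a N k -> Y}, forall n, g (quotmod_pi _ n) = f n.
Proof.
move=> fk.
apply: (factor_surj (p := quotmod_pi (ideal_mulT N (ideal_pow a k)))) => [|n].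
  by elim/quotmod_ind => n; exists n.
move=> /quotmod_pi_eq0/asboolP[s [sP ->]]; rewrite raddf_sum big_seq big1 // => p /sP[pa _].
exact: etrans (linearZ_LR f _ _) (fk _ _ pa).
Qed.

Lemma quot_pow_killed N k (q : quot_pow a N k) : killed a k q.
Proof.
elim/quotmod_ind: q => n r ra; rewrite -linearZ; apply/quotmod_pi_eq0/asboolP.
by exists [:: (r, n)]; rewrite big_seq1; split=> // p; rewrite inE => /eqP ->.
Qed.

Lemma fin_gen_killed N Y (f : {linear N -> Gam a Y}) : fin_gen_module N ->
  exists K, forall k n, (K <= k)%N -> killed a k (val (f n)).
Proof.
move=> N_fg.
have [||| K KP] := fin_gen_chain (U := fun k n => killed a k (val (f n))) N_fg.
- move=> k; split=> [|c x y hx hy]; first by rewrite raddf0; apply: (killed_linpred a Y k).1.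
  by rewrite linearP; apply: (killed_linpred a Y k).2.
- by move=> k n; apply: killed_mono.
- by move=> n _; apply: GamP.
by exists K => k n Kk; apply: killed_mono Kk (KP n _).
Qed.

Lemma Gam_lift N k Y (f : {linear quot_pow a N k -> Y}) :
  exists g : {linear N -> Gam a Y}, forall n, val (g n) = f (quotmod_pi _ n).
Proof.
apply: (@factor_inj R (Gam a Y) Y N val (f \o quotmod_pi _)) => [|n].
  exact: val_inj.
have fk : exists l, killed a l (f (quotmod_pi _ n)).
  by exists k => r ra; rewrite -linearZ quot_pow_killed ?raddf0.
by exists (mkGam fk).
Qed.

(** In the limit, maps from [N / a^k N] to [Z] become maps from [N] to the torsion
    of [Z]: finite generation of [N] supplies the exponent [k], both for a map to
    [Gam a Z] and for a lift of it to [Gam a E]. *)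
Lemma gen_loc_rel i N X E Z (p : {linear E -> Z}) :
  fin_gen_module N -> shift_spec i X p ->
  exists rho : gen_local_cohomology a i N X -> {linear N -> Gam a Z} -> Prop,
  [/\ linrel rho, forall l, exists h, rho l h, forall h, exists l, rho l h &
    forall l h, rho l h -> (l = 0 <-> lifts_to (Gam_map a p) h)].
Proof.
move=> N_fg [Sh [[Shl Sht] Shs Shk Shn]].
apply: (direct_limit_rel (Q := fun k x (h : {linear N -> Gam a Z}) =>
  exists hb : {linear quot_pow a N k -> Z}, exists w,
  [/\ Sh _ hb w, x = cls w & forall n, hb (quotmod_pi _ n) = val (h n)])).
- move=> k; split=> [|c x h x' h' [hb [w [hw -> hh]]] [hb' [w' [hw' -> hh']]]].
    exists 0, 0; split=> //; first by case: (Shl (quot_pow a N k)).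
    by apply/esym/cls0/bnd_0.
  exists (c *: hb + hb'), (c *: w + w'); split; first exact: (Shl _).2.
    by rewrite clsP.
  by move=> n /=; rewrite hh hh'.
- move=> k x h [hb [w [hw -> hh]]].
  exists (hb \o quot_pow_map a N k), (w \o syzn_map (quot_pow_map a N k) i).
  split; [exact: Shn | exact: cls_map |].
  by move=> n /=; rewrite quotmod_mapE -hh.
- move=> k x; have [w ->] := cls_surj x; have [hb [w' [hw' ww']]] := Shs _ w.
  have [h hP] := Gam_lift hb; exists h, hb, w'; split=> //.
  exact: cls_eq.
- move=> h; have [K KP] := fin_gen_killed h N_fg.
  have [|hb hbP] := @quot_pow_factor N Z K (val \o h).
    by move=> n; apply: KP.
  by have [w hw] := Sht _ hb; exists K, (cls w), hb, w.
- move=> k h [hb [w [hw /esym/cls0/(Shk _ _ _ hw) [g gP] hh]]].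
  have [g' g'P] := Gam_lift g; exists g' => n; apply: val_inj.
  by rewrite Gam_mapE g'P -gP hh.
move=> h [g gP]; have [K KP] := fin_gen_killed g N_fg.
exists K => k x Kk [hb [w [hw -> hh]]]; apply/cls0/(Shk _ _ _ hw).
have [|gb gbP] := @quot_pow_factor N E k (val \o g).
  by move=> n; apply: KP.
by exists gb; elim/quotmod_ind => n; rewrite hh gP gbP.
Qed.

Lemma regular_fin_gen : fin_gen_module (R^o : lmodType R).
Proof.
exists [:: 1] => x; split=> // _; exists (fun=> x).
by rewrite big_ord1 /= /GRing.scale /= mulr1.
Qed.

(** The coboundaries and the cohomology in degree [i] of the torsion of the
    injective resolution. *)
Definition cosyz_bound i X : lmodType R := submodule (im (Gam_map a (precosyz_map i X))).
Definition inj_cohomology i X : lmodType R := quotmod (im (Gam_map a (precosyz_map i X))).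

(** [gen_loc_rel] for [N = R], a map out of [R] being determined by its value
    at [1]. *)
Lemma inj_cohomology_iso i X :
  exists (f : {linear local_cohomology a i X -> inj_cohomology i X})
         (g : {linear inj_cohomology i X -> local_cohomology a i X}),
  cancel f g /\ cancel g f.
Proof.
have [rho [rl rt rs rk]] := gen_loc_rel regular_fin_gen (shift_specP i X).
pose Gp := Gam_map a (precosyz_map i X).
pose sig (l : local_cohomology a i X) (q : inj_cohomology i X) :=
  exists2 h, rho l h & q = quotmod_pi (im Gp) (h 1).
have sigl : linrel sig.
  split=> [|c l _ l' _ [h lh ->] [h' lh' ->]].
    by exists 0; [case: rl | rewrite raddf0].
  by exists (c *: h + h'); [apply: rl.2 | rewrite -linearP].
have sig0 l q : sig l q -> (l = 0 <-> q = 0).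
  move=> [h lh ->]; rewrite (rk _ _ lh) quotmod_pi_eq0 imP.
  split=> [[g gP]|[y yP]]; first by exists (g 1).
  have hl : linear (fun r : R^o => (r : R) *: y).
    by move=> c u v; rewrite scalerDl scalerA.
  exists (mklin hl) => r /=; rewrite linearZ -[Gam_map _ _ y]/(Gp y) yP.
  by rewrite -linearZ /GRing.scale /= mulr1.
have sig_tot l : exists q, sig l q.
  by have [h lh] := rt l; exists (quotmod_pi (im Gp) (h 1)), h.
have sig_surj q : exists l, sig l q.
  elim/quotmod_ind: q => y.
  have hl : linear (fun r : R^o => (r : R) *: y).
    by move=> c u v; rewrite scalerDl scalerA.
  have [l lh] := rs (mklin hl); exists l, (mklin hl) => //.
  by rewrite /= scale1r.
have [|f fP] := linrel_fun sigl sig_tot; first by move=> q /sig0 <-.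
have [||g gP] := @linrel_fun _ _ _ (fun q l => sig l q) _ sig_surj.
- by split=> [|c q l q' l' h h']; [case: sigl | apply: sigl.2].
- by move=> l /sig0 ->.
exists f, g; split=> x; apply/eqP; rewrite -subr_eq0; apply/eqP.
  apply/(sig0 _ 0) => //; rewrite -(subrr (f x)); exact: linrelB (gP _) (fP _).
apply/(sig0 0) => //; rewrite -(subrr (g x)); exact: linrelB (fP _) (gP _).
Qed.
End LocalCohomologyCokernel.

(** * Bounds for Ext modules *)

Section ExtBounds.
Variables (R : comNzRingType) (S : lmodType R -> Prop) (S_serre : serre S).
Variables (disp : Order.disp_t) (T : porderType disp) (e : T).
Variables (star : Monoid.com_law e) (star_mono : star_monotone star).
Variables (lambda : lmodType R -> T) (lambda_sub : subadditive star S lambda).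
Variable M : lmodType R.

Local Notation bounded := (bounded S lambda).

Definition post_cls (Y Z : lmodType R) (f : {linear Y -> Z}) i
    (c : Ext i M Y) (c' : Ext i M Z) : Prop :=
  exists2 h, c = cls h & c' = cls (f \o h).

Lemma post_cls_linrel (Y Z : lmodType R) (f : {linear Y -> Z}) i :
  linrel (@post_cls Y Z f i).
Proof.
split=> [|c _ _ _ _ [h -> ->] [h' -> ->]].
  by exists 0; apply/esym/cls0; [apply: bnd_0|apply: bnd_comp (bnd_0 _ _ _)].
exists (c *: h + h'); rewrite -clsP //; congr cls.
by apply: linear_ext => x /=; rewrite linearP.
Qed.

Lemma post_cls_total (Y Z : lmodType R) (f : {linear Y -> Z}) i (c : Ext i M Y) :
  exists c', post_cls f c c'.
Proof. by have [h ->] := cls_surj c; exists (cls (f \o h)), h. Qed.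

Lemma bounded_Ext_iso i (A B : lmodType R) (f : {linear A -> B})
    (g : {linear B -> A}) t : cancel g f ->
  bounded (Ext i M A) t -> bounded (Ext i M B) t.
Proof.
move=> gf; apply: (bounded_rel S_serre lambda_sub (rho := @post_cls B A g i)).
- exact: post_cls_linrel.
- exact: post_cls_total.
- move=> _ [h -> /esym/cls0/(bnd_comp f) b]; apply/cls0; apply: bnd_eq b => x /=.
  by rewrite gf.
Qed.

(** The next three lemmas read a bound off the exactness of the long exact sequence
    at each of its three kinds of terms; the two after them apply when the Ext
    module of the middle term vanishes in the relevant degree. *)
Section ShortExact.
Variables (A B C : lmodType R) (io : {linear A -> B}) (pi : {linear B -> C}).
Hypothesis ex : short_exact io pi.

Definition conn_cls i (c : Ext i M C) (a : Ext i.+1 M A) : Prop :=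
  exists h, exists2 w, conn io pi h w & c = cls h /\ a = cls w.

Lemma conn_cls_linrel i : linrel (@conn_cls i).
Proof.
split=> [|c _ _ _ _ [h [w hw [-> ->]]] [h' [w' hw' [-> ->]]]].
  exists 0, 0; first by case: (conn_linrel M io pi i).
  by split; apply/esym/cls0/bnd_0.
exists (c *: h + h'), (c *: w + w'); first exact: (conn_linrel _ _ _ _).2.
by rewrite !clsP.
Qed.

Lemma conn_cls_total i (c : Ext i M C) : exists a, conn_cls c a.
Proof.
have [h ->] := cls_surj c; have [w hw] := conn_total ex h.
by exists (cls w), h, w.
Qed.

Lemma bounded_Ext_middle i s t : bounded (Ext i M A) s ->
  bounded (Ext i M C) t -> bounded (Ext i M B) (star s t).
Proof.
apply: (bounded_exact S_serre star_mono lambda_sub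
  (tau := fun c c' => post_cls io c' c) (sigma := @post_cls B C pi i)).
- exact: linrel_flip (post_cls_linrel io i).
- exact: post_cls_linrel.
- exact: post_cls_total.
- move=> _ [h -> /esym/cls0 b]; have [w hw] := Ext_middle ex b.
  by exists (cls w), w => //; apply: cls_eq.
- by move=> _ [h /esym/cls0 b ->]; apply/cls0/bnd_comp.
Qed.

Lemma bounded_Ext_right i s t : bounded (Ext i M B) s ->
  bounded (Ext i.+1 M A) t -> bounded (Ext i M C) (star s t).
Proof.
apply: (bounded_exact S_serre star_mono lambda_sub
  (tau := fun c c' => post_cls pi c' c) (sigma := @conn_cls i)).
- exact: linrel_flip (post_cls_linrel pi i).
- exact: conn_cls_linrel.
- exact: conn_cls_total.
- move=> _ [h [w hw [-> /esym/cls0 bw]]]; have [h' h'P] := conn_bnd ex hw bw.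
  by exists (cls h'), h' => //; congr cls; apply: linear_ext => x; rewrite /= h'P.
- by move=> _ [h /esym/cls0 b ->]; apply/cls0/bnd_comp.
Qed.

Lemma bounded_Ext_left i s t : bounded (Ext i M C) s ->
  bounded (Ext i.+1 M B) t -> bounded (Ext i.+1 M A) (star s t).
Proof.
apply: (bounded_exact S_serre star_mono lambda_sub
  (tau := fun c c' => conn_cls c' c) (sigma := @post_cls A B io i.+1)).
- exact: linrel_flip (conn_cls_linrel i).
- exact: post_cls_linrel.
- exact: post_cls_total.
- move=> _ [w -> /esym/cls0 b]; have [h hw] := conn_exact ex b.
  by exists (cls h), h, w.
- by move=> _ [h [w hw [/esym/cls0 b ->]]]; apply/cls0/(bnd_conn ex hw b).
Qed.

Lemma bounded_Ext_conn i t : (forall h : {linear syzn i M -> B}, bnd h) ->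
  bounded (Ext i.+1 M A) t -> bounded (Ext i M C) t.
Proof.
move=> B0; apply: (bounded_rel S_serre lambda_sub (rho := @conn_cls i)).
- exact: conn_cls_linrel.
- exact: conn_cls_total.
- move=> _ [h [w hw [-> /esym/cls0 bw]]]; have [h' h'P] := conn_bnd ex hw bw.
  apply/cls0; apply: bnd_eq (bnd_comp pi (B0 h')); exact: h'P.
Qed.

Lemma bounded_Ext_conn_inv i t : (forall h : {linear syzn i.+1 M -> B}, bnd h) ->
  bounded (Ext i M C) t -> bounded (Ext i.+1 M A) t.
Proof.
move=> B0; apply: (bounded_rel S_serre lambda_sub (rho := fun a c => conn_cls c a)).
- exact: linrel_flip (conn_cls_linrel i).
- move=> c; have [w ->] := cls_surj c; have [h hw] := conn_exact ex (B0 (io \o w)).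
  by exists (cls h), h, w.
- by move=> _ [h [w hw [/esym/cls0 b ->]]]; apply/cls0/(bnd_conn ex hw b).
Qed.
End ShortExact.
End ExtBounds.

(** * The two chains of exact sequences *)

Section MainBounds.
Variables (R : comNzRingType) (R_noeth : noetherian R) (a : submodClosed R^o).
Variables (S : lmodType R -> Prop) (S_serre : serre S).
Variables (disp : Order.disp_t) (T : porderType disp) (e : T).
Variables (star : Monoid.com_law e) (star_mono : star_monotone star).
Variables (lambda : lmodType R -> T) (lambda_sub : subadditive star S lambda).
Variables (M : lmodType R) (M_fg : fin_gen_module M) (X : lmodType R).

Local Notation bounded := (bounded S lambda).
Local Notation Z q := (Gam a (cosyzn q X)).
Local Notation B q := (cosyz_bound a q X).
Local Notation H q := (inj_cohomology a q X).
Local Notation J q := (Gam a (env (cosyzn q X))).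

Lemma Gam_env_Ext i q (h : {linear syzn i.+1 M -> J q}) : bnd h.
Proof. exact/Ext_injective/Gam_injective/env_injective. Qed.

Lemma Gam_env_short_exact q : exists g : {linear J q -> B q.+1},
  short_exact (Gam_map a (env_incl (cosyzn q X))) g /\
  forall x, val (g x) = Gam_map a (cosyz_pi (cosyzn q X)) x.
Proof.
have ex := env_short_exact (cosyzn q X).
have [|g gP] := @factor_inj _ (B q.+1) _ _ val (Gam_map a (cosyz_pi (cosyzn q X))) val_inj.
  move=> x.
  have xi : Gam_map a (cosyz_pi (cosyzn q X)) x \in im (Gam_map a (precosyz_map q.+1 X)).
    by apply/imP; exists x.
  by exists (Submodule xi).
exists g; split=> //; split.
- move=> x y /(congr1 val) xy; apply: val_inj; case: ex => + _ _; apply; exact: xy.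
- move=> x; split=> [gx0|[y <-]].
    by apply: (Gam_left_exact ex); rewrite -gP gx0.
  apply: val_inj; rewrite gP; apply: val_inj => /=.
  by case: ex => _ + _ => -> ; exists (val y).
move=> [y yi]; have /imP[x xy] := yi; exists x; apply: val_inj; rewrite gP.
exact: xy.
Qed.

(** Downward induction: [Ext^p(B_{q+1})] embeds in [Ext^{p+1}(Z_q)], which lies
    between [Ext^{p+1}(B_q)] and [Ext^{p+1}(H_q)].  The degree is positive so that
    the Ext module of the injective middle term vanishes. *)
Lemma bounded_Ext_bound q p (t : nat -> T) :
  (forall r, (1 <= r <= q)%N -> bounded (Ext (p.+1 + r) M (H (q - r))) (t r)) ->
  bounded (Ext p.+1 M (B q)) (\big[star/e]_(1 <= r < q.+1) t r).
Proof.
elim: q p t => [|q IH] p t ht.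
  rewrite big_geq //; apply: (bounded0 S_serre lambda_sub) => c.
  have [h ->] := cls_surj c; apply/cls0; rewrite (_ : h = 0); first exact: bnd_0.
  apply: linear_ext => x; case: (h x) => y yi; apply: val_inj.
  by have /imP[z zy] := yi; rewrite /= -zy; apply: val_inj.
have [g [ex _]] := Gam_env_short_exact q.
apply: (bounded_Ext_conn S_serre lambda_sub ex); first exact: Gam_env_Ext.
rewrite big_ltn // big_add1 /= Monoid.mulmC.
apply: (bounded_Ext_middle S_serre star_mono lambda_sub (sub_short_exact _)).
  apply: (IH p.+1 (fun r => t r.+1)) => r /andP[r1 rq].
  by have := ht r.+1; rewrite subSS -addSnnS; apply.
by have := ht 1%N; rewrite subSS subn0 addn1; apply.
Qed.

(** Upward induction: [Ext^{p+2}(Z_q)] is a quotient of [Ext^{p+1}(B_{q+1})], which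
    lies between [Ext^p(H_{q+1})] and [Ext^{p+1}(Z_{q+1})].  At the end
    [Ext^1(Z_q)] is the cokernel of [Hom(M, J_q) -> Hom(M, B_{q+1})], contained in
    that of [Hom(M, J_q) -> Hom(M, Z_{q+1})]. *)
Lemma bounded_Ext_cocycle p q s (t : nat -> T) :
  bounded (gen_local_cohomology a (p.+1 + q) M X) s ->
  (forall r, (1 <= r <= p)%N -> bounded (Ext (p - r) M (H (q + r))) (t r)) ->
  bounded (Ext p.+1 M (Z q)) (star s (\big[star/e]_(1 <= r < p.+1) t r)).
Proof.
elim: p q t => [|p IH] q t hs ht; have [g [ex gP]] := Gam_env_short_exact q.
  rewrite big_geq // Monoid.mulm1; move: hs; rewrite add1n.
  have [rho [rl rt rs rk]] := gen_loc_rel a M_fg (shift_specP q.+1 X).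
  apply: (bounded_rel S_serre lambda_sub (rho := fun (c : Ext 1 M (Z q)) l =>
    exists (h : {linear M -> B q.+1}) (w : {linear syzn 1 M -> Z q})
      (h' : {linear M -> Z q.+1}), [/\ c = cls w, conn (Gam_map a (env_incl (cosyzn q X))) g (i := 0) h w,
        (forall x, h' x = val (h x)) & rho l h'])).
  - split=> [|c _ l _ l' [h [w [h1 [-> hw hE lh]]]] [h' [w' [h1' [-> hw' hE' lh']]]]].
      exists 0, 0, 0; split; [exact/esym/cls0/bnd_0 | | by [] | by case: rl].
      exact: (conn_linrel _ _ _ _).1.
    exists (c *: h + h'), (c *: w + w'), (c *: h1 + h1'); split; first by rewrite clsP.
    + exact: (conn_linrel _ _ _ _).2.
    + by move=> x /=; rewrite hE hE'.
    + exact: rl.2.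
  - move=> c; have [w ->] := cls_surj c.
    have [h hw] := conn_exact ex (Gam_env_Ext (Gam_map a (env_incl (cosyzn q X)) \o w)).
    by have [l lh] := rs (val \o h); exists l, h, w, (val \o h).
  - move=> _ [h [w [h' [-> hw hE /rk [/(_ erefl)[f fP] _]]]]]; apply/cls0.
    apply: (@conn_lift _ M _ _ _ _ _ ex 0 f h w) hw => x; apply: val_inj.
    by rewrite gP -hE fP.
apply: (bounded_Ext_conn_inv S_serre lambda_sub ex); first exact: Gam_env_Ext.
rewrite big_ltn // big_add1 /= Monoid.mulmCA.
apply: (bounded_Ext_left S_serre star_mono lambda_sub (sub_short_exact _)).
  by have := ht 1%N; rewrite subSS subn0 addn1; apply.
apply: (IH q.+1 (fun r => t r.+1)); first by rewrite -addSnnS.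
move=> r /andP[r1 rp]; have := ht r.+1; rewrite subSS -addSnnS; apply.
by rewrite ltnS.
Qed.

Lemma bounded_Ext_cohomology m n s (t u : nat -> T) :
  bounded (gen_local_cohomology a (m + n) M X) s ->
  (forall r, (1 <= r <= n)%N -> bounded (Ext (m + 1 + r) M (H (n - r))) (t r)) ->
  (forall r, (1 <= r <= m - 1)%N -> bounded (Ext (m - 1 - r) M (H (n + r))) (u r)) ->
  bounded (Ext m M (H n)) (star (star s (\big[star/e]_(1 <= r < n.+1) t r))
    (\big[star/e]_(1 <= r < (m - 1).+1) u r)).
Proof.
move=> hs ht hu.
have hB : bounded (Ext m.+1 M (B n)) (\big[star/e]_(1 <= r < n.+1) t r).
  by apply: bounded_Ext_bound => r /ht; rewrite addn1.
have ex := sub_short_exact (im (Gam_map a (precosyz_map n X))).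
case: m hs ht hu hB => [|m] hs ht hu hB.
  (* Hom(M, Z_n) itself is not bounded; its image in Hom(M, H_n) is *)
  rewrite [X in star _ X]big_geq // Monoid.mulm1; move: hs hB; rewrite add0n.
  have [rho [rl rt rs rk]] := gen_loc_rel a M_fg (shift_specP n X).
  apply: (bounded_exact S_serre star_mono lambda_sub
    (tau := fun (c : Ext 0 M (H n)) l => exists h : {linear M -> Z n},
        c = cls (i := 0) (quotmod_pi _ \o h) /\ rho l h)
    (sigma := @conn_cls _ M _ _ _ val (quotmod_pi _) 0)).
  - split=> [|c _ l _ l' [h [-> lh]] [h' [-> lh']]].
      exists 0; split; last by case: rl.
      by apply/esym/cls0 => x /=; rewrite raddf0.
    exists (c *: h + h'); split; last exact: rl.2.
    rewrite -clsP; congr cls; apply: linear_ext => x /=; by rewrite linearP.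
  - exact: conn_cls_linrel.
  - exact: (conn_cls_total ex).
  - move=> _ [h [w hw [-> /esym/cls0 bw]]]; have [h' h'P] := conn_bnd ex hw bw.
    have [l lh] := rs h'; exists l, h'; split=> //; congr cls.
    by apply: linear_ext => x; rewrite /= h'P.
  - move=> _ [h [-> /rk [/(_ erefl)[f fP] _]]]; apply/cls0 => x /=.
    by apply/quotmod_pi_eq0/imP; exists (f x).
rewrite Monoid.mulmAC.
apply: (bounded_Ext_right S_serre star_mono lambda_sub ex) hB.
by rewrite subn1; apply: bounded_Ext_cocycle => // r; move: (hu r); rewrite subn1.
Qed.
End MainBounds.

Theorem theorem2p13 (R : comNzRingType) (R_noeth : noetherian R)
  (a : submodClosed R^o)
  (S : lmodType R -> Prop) (S_serre : serre S)
  (disp : Order.disp_t) (T : porderType disp) (e : T)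
  (star : Monoid.com_law e) (star_mono : star_monotone star)
  (lambda : lmodType R -> T) (lambda_sub : subadditive star S lambda)
  (M : lmodType R) (M_fg : fin_gen_module M) (X : lmodType R) (m n : nat)
  (h1 : S (gen_local_cohomology a (m + n) M X))
  (h2 : forall r : nat, (1 <= r <= n)%N ->
    S (Ext (m + 1 + r) M (local_cohomology a (n - r) X)))
  (h3 : forall r : nat, (1 <= r <= m - 1)%N ->
    S (Ext (m - 1 - r) M (local_cohomology a (n + r) X))) :
  S (Ext m M (local_cohomology a n X)) /\
  (lambda (Ext m M (local_cohomology a n X)) <=
    star (star (lambda (gen_local_cohomology a (m + n) M X))
      (\big[star/e]_(1 <= r < n.+1)
         lambda (Ext (m + 1 + r) M (local_cohomology a (n - r) X))))
      (\big[star/e]_(1 <= r < (m - 1).+1)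
         lambda (Ext (m - 1 - r) M (local_cohomology a (n + r) X))))%O.
Proof.
have Hiso i q t : bounded S lambda (Ext i M (local_cohomology a q X)) t ->
    bounded S lambda (Ext i M (inj_cohomology a q X)) t.
  have [f [g [_ gf]]] := inj_cohomology_iso a q X.
  exact: (bounded_Ext_iso S_serre lambda_sub gf).
have [f [g [fg _]]] := inj_cohomology_iso a n X.
apply: (bounded_Ext_iso S_serre lambda_sub fg).
apply: (bounded_Ext_cohomology R_noeth S_serre star_mono lambda_sub M_fg) => [|r hr|r hr].
- by split.
- by apply: Hiso; split=> //; apply: h2.
- by apply: Hiso; split=> //; apply: h3.
Qed.
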